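(* Let $\Omega,d,N,T,\mathcal D,A,\boldsymbol f,s,\boldsymbol u,\gamma,C_f,\boldsymbol\rho_0$ satisfy the structural assumptions listed in the context, let $\varepsilon>0$, let $\mathcal T_h$ be a mesh of $\Omega$ and $0=t_0<\dots<t_{N_t}=T$ a partition of $(0,T)$ with steps $\tau_n=t_n-t_{n-1}$. Let $\{(\boldsymbol w_h^{\varepsilon,n},\underline{\boldsymbol\sigma}_h^{\varepsilon,n})\}_{n=1}^{N_t}$ be any solution of the fully discrete regularized LDG--backward Euler scheme described in the context. Then $$\varepsilon\tau_1\|\boldsymbol w_h^{\varepsilon,1}\|_C^2+\int_\Omega s(\boldsymbol u(\boldsymbol w_h^{\varepsilon,1}))\,d\boldsymbol x+\gamma\tau_1\|\underline{\boldsymbol\sigma}_h^{\varepsilon,1}\|_{[L^2(\Omega)^d]^N}^2+\tau_1\big\|\eta_F^{1/2}[\![\boldsymbol w_h^{\varepsilon,1}]\!]_{\sf N}\big\|_{[L^2(\mathcal F_h^{\mathcal I})^d]^N}^2\le\int_\Omega s(\boldsymbol\rho_0)\,d\boldsymbol x+C_f\tau_1|\Omega|;$$ for $n=1,\dots,N_t-1$, $$\varepsilon\tau_{n+1}\|\boldsymbol w_h^{\varepsilon,n+1}\|_C^2+\int_\Omega s(\boldsymbol u(\boldsymbol w_h^{\varepsilon,n+1}))\,d\boldsymbol x+\gamma\tau_{n+1}\|\underline{\boldsymbol\sigma}_h^{\varepsilon,n+1}\|_{[L^2(\Omega)^d]^N}^2+\tau_{n+1}\big\|\eta_F^{1/2}[\![\boldsymbol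 w_h^{\varepsilon,n+1}]\!]_{\sf N}\big\|_{[L^2(\mathcal F_h^{\mathcal I})^d]^N}^2\le\int_\Omega s(\boldsymbol u(\boldsymbol w_h^{\varepsilon,n}))\,d\boldsymbol x+C_f\tau_{n+1}|\Omega|;$$ and $$\varepsilon\sum_{n=0}^{N_t-1}\tau_{n+1}\|\boldsymbol w_h^{\varepsilon,n+1}\|_C^2+\int_\Omega s(\boldsymbol u(\boldsymbol w_h^{\varepsilon,N_t}))\,d\boldsymbol x+\gamma\sum_{n=0}^{N_t-1}\tau_{n+1}\|\underline{\boldsymbol\sigma}_h^{\varepsilon,n+1}\|_{[L^2(\Omega)^d]^N}^2+\sum_{n=0}^{N_t-1}\tau_{n+1}\big\|\eta_F^{1/2}[\![\boldsymbol w_h^{\varepsilon,n+1}]\!]_{\sf N}\big\|_{[L^2(\mathcal F_h^{\mathcal I})^d]^N}^2\le\int_\Omega s(\boldsymbol\rho_0)\,d\boldsymbol x+C_fT|\Omega|.$$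
   Context: **Structural assumptions.** $d\in\{1,2,3\}$, $N\in\mathbb N$, $T>0$, $\Omega\subset\mathbb R^d$ is a bounded polytopic domain with Lipschitz boundary. $\mathcal D\subset(0,\infty)^N$ is a bounded domain; $A\in C^0(\overline{\mathcal D};\mathbb R^{N\times N})$, $\boldsymbol f\in C^0(\overline{\mathcal D};\mathbb R^N)$. There is a convex function $s\in C^2(\mathcal D;(0,\infty))\cap C^0(\overline{\mathcal D};(0,\infty))$ with $s':\mathcal D\to\mathbb R^N$ invertible and $\boldsymbol u:=(s')^{-1}\in C^1(\mathbb R^N;\mathcal D)$, and constants $\gamma>0$, $C_f\ge0$ with $\boldsymbol z\cdot(s''(\boldsymbol\rho)A(\boldsymbol\rho)\boldsymbol z)\ge\gamma|\boldsymbol z|^2$ for all $\boldsymbol z\in\mathbb R^N$, $\boldsymbol\rho\in\mathcal D$, and $\boldsymbol f(\boldsymbol\rho)\cdot s'(\boldsymbol\rho)\le C_f$ for all $\boldsymbol\rho\in\mathcal D$. The initial datum $\boldsymbol\rho_0\in L^\infty(\Omega)^N$ satisfies $\boldsymbol\rho_0(\boldsymbol x)\in\mathcal D$ for a.e. $\boldsymbol x\in\Omega$. For $N\times d$ matrices, $P:Q=\mathrm{tr}(Q^{\sf T}P)$; products such as $A\,\underline{\boldsymbol\sigma}$ are matrix products ($N\times N$ times $N\times d$). **Mesh and spaces.** $\mathcal T_h$ is a conforming simplicial mesh of $\Omega$ with mesh size $h=\max_K h_K$, $h_K=\mathrm{diam}\,K$, belonging for $d=2,3$ to a shape-regular family ($\Upsilon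 h_K\le\varrho_K$ for all $K$, $\varrho_K$ the inradius, $\Upsilon>0$ independent of $h$). $\mathcal F_h^{\mathcal I}$, $\mathcal F_h^{\mathcal N}$ are the sets of interior and boundary facets; integrals over $\mathcal F_h^\star$ are sums of facet integrals. For a fixed polynomial degree $p$, $\mathcal S_p(\mathcal T_h)$ is the space of functions that are polynomials of degree $\le p$ on each $K\in\mathcal T_h$ (no continuity), and $\boldsymbol{\mathcal M}_p(\mathcal T_h)=\mathcal S_p(\mathcal T_h)^d$; elements of $\boldsymbol{\mathcal M}_p(\mathcal T_h)^N$ are $N\times d$ matrix valued. For $F=\partial K_1\cap\partial K_2\in\mathcal F_h^{\mathcal I}$ with a fixed unit normal $\underline n_F$ pointing out of $K_1$ and a fixed weight $\alpha_F\in[0,1]$: $[\![\mu]\!]_{\sf N}=(\mu_{|K_1}-\mu_{|K_2})\underline n_F$ for scalar $\mu$ (componentwise for vectors $\boldsymbol\mu$), $[\![\underline\psi]\!]_{\sf N}=(\underline\psi_{|K_1}-\underline\psi_{|K_2})\cdot\underline n_F$ for $d$-vector valued $\underline\psi$, $\{\!\{\mu\}\!\}_{\alpha_F}=(1-\alpha_F)\mu_{|K_1}+\alpha_F\mu_{|K_2}$. $\mathsf h=\eta^{-1}\min\{h_{K_1},h_{K_2}\}$ on $F$, with a constant $\eta>0$ independent of $h$, and $\eta_F=\mathsf h_{|F}^{-1}\|A\|_{L^\infty(\mathcal D)^{N\times N}}$. **Forms.** For $w_h,\lambda_h\in\mathcal S_p(\mathcal T_h)$, $\underline\psi_h\in\boldsymbol{\mathcal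 M}_p(\mathcal T_h)$, $$b_h(w_h,\underline\psi_h)=-\int_{\mathcal F_h^{\mathcal I}}\{\!\{w_h\}\!\}_{\alpha_F}[\![\underline\psi_h]\!]_{\sf N}\,dS-\int_{\mathcal F_h^{\mathcal N}}w_h\underline\psi_h\cdot\underline n_\Omega\,dS+\sum_{K\in\mathcal T_h}\int_Kw_h\nabla\cdot\underline\psi_h\,d\boldsymbol x,\qquad s_h(w_h,\lambda_h)=\int_{\mathcal F_h^{\mathcal I}}\eta_F[\![w_h]\!]_{\sf N}\cdot[\![\lambda_h]\!]_{\sf N}\,dS .$$ For $\boldsymbol v_h\in\mathcal S_p(\mathcal T_h)^N$ let $\underline{\boldsymbol\zeta}_h(\boldsymbol v_h)\in\boldsymbol{\mathcal M}_p(\mathcal T_h)^N$ be defined by $\int_\Omega\underline{\boldsymbol\zeta}_h(\boldsymbol v_h):\underline{\boldsymbol\psi}_h\,d\boldsymbol x=\sum_{i=1}^Nb_h(v_{h,i},\underline\psi_{h,i})$ for all $\underline{\boldsymbol\psi}_h\in\boldsymbol{\mathcal M}_p(\mathcal T_h)^N$. Let $c_h$ be a symmetric positive definite bilinear form on $\mathcal S_p(\mathcal T_h)$ depending only on the space discretization (it is represented by a matrix $C$), $\boldsymbol c_h(\boldsymbol w_h,\boldsymbol v_h)=\sum_{i=1}^Nc_h(w_{h,i},v_{h,i})$ and $\|\boldsymbol w_h\|_C^2=\boldsymbol c_h(\boldsymbol w_h,\boldsymbol w_h)$. **Fully discrete scheme.** Let $\Pi_p^0$ be the $L^2(\Omega)$-orthogonal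 projection onto $\mathcal S_p(\mathcal T_h)^N$. Set $\boldsymbol\rho_h^{\varepsilon,0}=\Pi_p^0\boldsymbol\rho_0$ and $\boldsymbol\rho_h^{\varepsilon,n}=\boldsymbol u(\boldsymbol w_h^{\varepsilon,n})$ for $n\ge1$. For $n=0,\dots,N_t-1$, find $(\boldsymbol w,\underline{\boldsymbol\sigma})=(\boldsymbol w_h^{\varepsilon,n+1},\underline{\boldsymbol\sigma}_h^{\varepsilon,n+1})\in\mathcal S_p(\mathcal T_h)^N\times\boldsymbol{\mathcal M}_p(\mathcal T_h)^N$ such that $$\int_\Omega A(\boldsymbol u(\boldsymbol w))^{\sf T}s''(\boldsymbol u(\boldsymbol w))\underline{\boldsymbol\sigma}:\underline{\boldsymbol\varphi}_h\,d\boldsymbol x=\int_\Omega A(\boldsymbol u(\boldsymbol w))^{\sf T}\underline{\boldsymbol\zeta}_h(\boldsymbol w):\underline{\boldsymbol\varphi}_h\,d\boldsymbol x\quad\forall\underline{\boldsymbol\varphi}_h\in\boldsymbol{\mathcal M}_p(\mathcal T_h)^N,$$ $$\varepsilon\tau_{n+1}\boldsymbol c_h(\boldsymbol w,\boldsymbol\lambda_h)+\int_\Omega(\boldsymbol u(\boldsymbol w)-\boldsymbol\rho_h^{\varepsilon,n})\cdot\boldsymbol\lambda_h\,d\boldsymbol x+\tau_{n+1}\int_\Omega A(\boldsymbol u(\boldsymbol w))\underline{\boldsymbol\sigma}:\underline{\boldsymbol\zeta}_h(\boldsymbol\lambda_h)\,d\boldsymbol x+\tau_{n+1}\sum_{i=1}^Ns_h(w_i,\lambda_{h,i})=\tau_{n+1}\int_\Omega\boldsymbol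 f(\boldsymbol u(\boldsymbol w))\cdot\boldsymbol\lambda_h\,d\boldsymbol x\quad\forall\boldsymbol\lambda_h\in\mathcal S_p(\mathcal T_h)^N.$$ *)

(* Defs.v *)
From HB Require Import structures.
From mathcomp Require Import all_boot all_order all_algebra.
From mathcomp Require Import all_classical all_reals all_analysis.
Set Implicit Arguments.
Unset Strict Implicit.
Unset Printing Implicit Defensive.
Import Order.TTheory GRing.Theory Num.Theory numFieldNormedType.Exports.
Local Open Scope classical_set_scope.
Local Open Scope ring_scope.

(* Points of R^n are row vectors.  The library norm on 'rV[R]_n is the max
   norm: it is only used for topological notions, Euclidean lengths are
   written with [dotv] and [enorm]. *)

Definition rV_display : measure_display. Proof. by constructor. Qed.

Section rV_measurable.
Context (R : realType) (n : nat).

Let coor (i : 'I_n) (x : 'rV[R]_n) : measurableTypeR R := x 0 i.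

Let rV_set0 : g_sigma_preimage coor set0.
Proof. exact: sigma_algebra0. Qed.

Let rV_setC A : g_sigma_preimage coor A -> g_sigma_preimage coor (~` A).
Proof. exact: sigma_algebraC. Qed.

Let rV_bigcup (F : (set 'rV[R]_n)^nat) :
  (forall i, g_sigma_preimage coor (F i)) ->
  g_sigma_preimage coor (\bigcup_i (F i)).
Proof. exact: sigma_algebra_bigcup. Qed.

(* the Borel sigma-algebra, as the product of n copies of that of R *)
HB.instance Definition _ := @isMeasurable.Build rV_display
  'rV[R]_n (g_sigma_preimage coor) rV_set0 rV_setC rV_bigcup.

Lemma measurable_coor (i : 'I_n) :
  measurable_fun [set: 'rV[R]_n]
    (fun x : 'rV[R]_n => x 0 i : measurableTypeR R).
Proof.
move=> _ Y mY; rewrite setTI; apply: sub_sigma_algebra => /=.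
rewrite -bigcup_seq/=; exists i => /=; first by rewrite mem_index_enum.
by exists Y => //; rewrite setTI.
Qed.

Lemma measurable_fun_rVP d (T : measurableType d) (f : T -> 'rV[R]_n) :
  measurable_fun [set: T] f <->
  forall i, measurable_fun [set: T] (fun x => f x 0 i : measurableTypeR R).
Proof.
split=> [mf i|mf]; first exact: (measurableT_comp (@measurable_coor i) mf).
move=> _ A mA; rewrite setTI.
suff : (image_set_system setT f measurable) A.
  by rewrite /image_set_system/= setTI.
move: A mA; apply: smallest_sub.
  by apply: sigma_algebra_image; exact: sigma_algebra_measurable.
move=> A; rewrite -bigcup_seq/= => -[i _ [B mB <-]].
rewrite /image_set_system/= !setTI.
by have := mf i measurableT B mB; rewrite setTI.
Qed.

End rV_measurable.

Section lebesgue_step.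
Context (R : realType) (n : nat).
Variable m : {sigma_finite_measure set 'rV[R]_n -> \bar R}.

Definition cons_rV (p : measurableTypeR R * 'rV[R]_n) : 'rV[R]_n.+1 :=
  \row_i oapp (fun j => p.2 0 j) p.1 (unlift ord0 i).

Lemma measurable_cons_rV : measurable_fun setT cons_rV.
Proof.
apply/measurable_fun_rVP => i; case: (unliftP ord0 i) => [j ->|->].
  rewrite (_ : (fun _ => _) =
      (fun x : 'rV[R]_n => x 0 j : measurableTypeR R) \o snd).
    exact: (measurableT_comp (@measurable_coor R n j) measurable_snd).
  by apply/funext => p /=; rewrite mxE liftK.
rewrite (_ : (fun _ => _) = fst); first exact: measurable_fst.
by apply/funext => p /=; rewrite mxE unlift_none.
Qed.

(* image of the product measure on R x R^n under the identification
   of R x R^n with R^(n+1) *)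
Definition lebesgue_step : set 'rV[R]_n.+1 -> \bar R :=
  pushforward (@lebesgue_measure R \x m)%E cons_rV.

Let step0 : lebesgue_step set0 = 0%E.
Proof. by rewrite /lebesgue_step /pushforward preimage_set0 measure0. Qed.

Let step_ge0 A : (0 <= lebesgue_step A)%E.
Proof. exact: (measure_ge0 (@lebesgue_measure R \x m)%E). Qed.

Let mstep A : measurable A -> measurable (cons_rV @^-1` A).
Proof.
by move=> mA; rewrite -[X in measurable X]setTI; exact: measurable_cons_rV.
Qed.

Let step_sigma_additive : semi_sigma_additive lebesgue_step.
Proof.
move=> F mF tF mUF; rewrite /lebesgue_step /pushforward preimage_bigcup.
apply: measure_semi_sigma_additive.
- by move=> k; exact: mstep.
- apply/trivIsetP => /= i j _ _ ij; rewrite -preimage_setI.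
  by move/trivIsetP : tF => /(_ _ _ _ _ ij) ->//; rewrite preimage_set0.
- by rewrite -preimage_bigcup; exact: mstep.
Qed.

HB.instance Definition _ := isMeasure.Build _ _ _ lebesgue_step
  step0 step_ge0 step_sigma_additive.

Let step_sigma_finite : sigma_finite setT lebesgue_step.
Proof.
pose uncons (x : 'rV[R]_n.+1) : measurableTypeR R * 'rV[R]_n :=
  (x 0 ord0, \row_j x 0 (lift ord0 j)).
have consK : cancel cons_rV uncons.
  move=> [a v]; rewrite /uncons /cons_rV !mxE unlift_none /=; congr pair.
  by apply/rowP => j; rewrite !mxE liftK.
have munc : measurable_fun setT uncons.
  apply/measurable_fun_pairP; split; first exact: measurable_coor.
  apply/measurable_fun_rVP => j.
  rewrite (_ : (fun _ => _) =
      (fun x : 'rV[R]_n.+1 => x 0 (lift ord0 j) : measurableTypeR R)).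
    exact: measurable_coor.
  by apply/funext => x /=; rewrite mxE.
have /sigma_finiteP[F [FT ndF Foo]] := sigma_finiteT (@lebesgue_measure R).
have /sigma_finiteP[G [GT ndG Goo]] := sigma_finiteT m.
exists (fun k => uncons @^-1` (F k `*` G k)).
  rewrite -preimage_bigcup; apply/esym/seteqP; split=> // x _ /=.
  have [i _ Fi] : (\bigcup_i F i) (uncons x).1 by rewrite -FT.
  have [j _ Gj] : (\bigcup_i G i) (uncons x).2 by rewrite -GT.
  exists (maxn i j) => //; split.
    exact: (subsetPset _ _ (ndF _ _ (leq_maxl i j))).
  exact: (subsetPset _ _ (ndG _ _ (leq_maxr i j))).
move=> k; have [mF Fk] := Foo k; have [mG Gk] := Goo k; split.
  by rewrite -[X in measurable X]setTI; apply: munc => //; exact: measurableX.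
rewrite /lebesgue_step /pushforward -comp_preimage.
rewrite (_ : uncons \o cons_rV = id) ?preimage_id; last exact/funext.
by rewrite product_measure1E// lte_mul_pinfty// ge0_fin_numE.
Qed.

HB.instance Definition _ := Measure_isSigmaFinite.Build _ _ _ lebesgue_step
  step_sigma_finite.

End lebesgue_step.

Fixpoint lebesgue_rV (R : realType) (n : nat) :
    {sigma_finite_measure set 'rV[R]_n -> \bar R} :=
  match n with
  | 0 => \d_(0 : 'rV[R]_0)
  | n'.+1 => lebesgue_step (lebesgue_rV R n')
  end.

Section euclidean.
Context (R : realType).

(* P : Q = tr(Q^T P); on row and column vectors, the usual inner product *)
Definition inner m n (P Q : 'M[R]_(m, n)) : R := \tr (Q^T *m P).

Definition enorm m n (P : 'M[R]_(m, n)) : R := Num.sqrt (inner P P).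

Definition grad n (f : 'rV[R]_n -> R) (x : 'rV[R]_n) : 'rV[R]_n :=
  \row_i 'D_(delta_mx 0 i) f x.

Definition hess n (f : 'rV[R]_n -> R) (x : 'rV[R]_n) : 'M[R]_n := 'J (grad f) x.

Definition C1_on m n (D : set 'rV[R]_m) (f : 'rV[R]_m -> 'rV[R]_n) : Prop :=
  forall x, D x ->
    differentiable f x /\ {for x, continuous (fun y => 'J f y)}.

Definition C2_on n (D : set 'rV[R]_n) (f : 'rV[R]_n -> R) : Prop :=
  (forall x, D x -> differentiable f x) /\ C1_on D (grad f).

(* D itself is not required to be convex: the inequality is only imposed
   at those convex combinations that belong to D *)
Definition convex_fun_on n (D : set 'rV[R]_n) (f : 'rV[R]_n -> R) : Prop :=
  forall (x y : 'rV[R]_n) (t : R), D x -> D y -> 0 <= t <= 1 ->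
    D (t *: x + (1 - t) *: y) ->
    f (t *: x + (1 - t) *: y) <= t * f x + (1 - t) * f y.

(* L^infinity(X) norm of a matrix valued function, for the max norm `|_|
   on matrices, i.e. the largest L^infinity(X) norm of an entry *)
Definition Linfty_ereal n a b (X : set 'rV[R]_n)
    (g : 'rV[R]_n -> 'M[R]_(a, b)) : \bar R :=
  'N[lebesgue_rV R n]_+oo [(fun x => (\1_X x * `|g x|)%:E)]%E.

Definition Linfty_norm n a b (X : set 'rV[R]_n)
    (g : 'rV[R]_n -> 'M[R]_(a, b)) : R := fine (Linfty_ereal X g).

Definition in_Linfty n a b (X : set 'rV[R]_n)
    (g : 'rV[R]_n -> 'M[R]_(a, b)) : Prop :=
  (forall i j, measurable_fun X (fun x => g x i j)) /\
  (Linfty_ereal X g < +oo)%E.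

Definition bounded_domain n (D : set 'rV[R]_n) : Prop :=
  [/\ D !=set0, open D, connected D & bounded_set D].

Definition boundary n (D : set 'rV[R]_n) : set 'rV[R]_n :=
  closure D `&` closure (~` D).

Definition hull n (I : finType) (P : {set I}) (x : I -> 'rV[R]_n) :
    set 'rV[R]_n :=
  [set y | exists l : I -> R, [/\ forall i, 0 <= l i,
     \sum_(i in P) l i = 1 & y = \sum_(i in P) l i *: x i]].

Definition polytopic n (D : set 'rV[R]_n) : Prop :=
  exists ss : seq (seq 'rV[R]_n),
    closure D = \bigcup_(s in [set` ss])
      hull [set: 'I_(size s)]%SET (fun i : 'I_(size s) => s`_i).

(* near each boundary point, D is the strict epigraph of a Lipschitz function
   in some direction e; [phi] is only used on the hyperplane orthogonal to e *)
Definition lipschitz_boundary n (D : set 'rV[R]_n) : Prop :=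
  forall x, boundary D x ->
    exists (e : 'rV[R]_n) (r : R) (phi : 'rV[R]_n -> R),
      [/\ enorm e = 1, 0 < r, [lipschitz phi y | y in setT] &
        forall y, ball x r y ->
          (D y <-> phi (y - inner y e *: e) < inner y e)].

Definition volume n (X : set 'rV[R]_n) : R := fine (lebesgue_rV R n X).

Definition diam n (X : set 'rV[R]_n) : R :=
  sup [set r | exists x y, [/\ X x, X y & r = enorm (x - y)]].

Definition inradius n (X : set 'rV[R]_n) : R :=
  sup [set r | 0 <= r /\
    exists c : 'rV[R]_n, forall y, enorm (y - c) <= r -> X y].

End euclidean.

(* A mesh is given by a family of vertices and a family of elements, each of
   which is the set of the indices of its vertices; faces are also represented
   by sets of vertex indices. *)
Record mesh (R : realType) (d : nat) := Mesh {
  nvert : nat;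
  nelt : nat;
  vert : 'I_nvert -> 'rV[R]_d;
  elt : 'I_nelt -> {set 'I_nvert} }.

(* For a facet F, [side1 F] and [side2 F] are the elements K_1 and K_2.  On a
   boundary facet only [side1 F] is meaningful: it is the element which has F
   as a facet, so that [normal F] is the outward unit normal of the domain. *)
Record facet_data (R : realType) (d : nat) (M : mesh R d) := FacetData {
  side1 : {set 'I_(nvert M)} -> 'I_(nelt M);
  side2 : {set 'I_(nvert M)} -> 'I_(nelt M);
  normal : {set 'I_(nvert M)} -> 'rV[R]_d;
  weight : {set 'I_(nvert M)} -> R }.

Section mesh.
Context (R : realType) (d : nat) (Om : set 'rV[R]_d) (M : mesh R d).
Implicit Types (k l : 'I_(nelt M)) (F P : {set 'I_(nvert M)}).

Definition cell k : set 'rV[R]_d := hull (elt k) (@vert _ _ M).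

Definition affinely_independent P : Prop :=
  forall c : 'I_(nvert M) -> R,
    \sum_(i in P) c i = 0 -> \sum_(i in P) c i *: vert i = 0 ->
    forall i, i \in P -> c i = 0.

Definition conforming_mesh : Prop :=
  [/\ injective (@elt _ _ M),
      forall k, #|elt k| = d.+1 /\ affinely_independent (elt k),
      closure Om = \bigcup_(k in setT) cell k &
      forall k l, cell k `&` cell l = hull (elt k :&: elt l) (@vert _ _ M)].

Definition shape_regular (Ups : R) : Prop :=
  forall k, Ups * diam (cell k) <= inradius (cell k).

Definition facets : {set {set 'I_(nvert M)}} :=
  [set F : {set 'I_(nvert M)} |
    (#|F| == d) && [exists k, F \subset elt k]]%SET.

Definition interior_facets : {set {set 'I_(nvert M)}} :=
  [set F in facets | [exists k, exists l,
    [&& k != l, F \subset elt k & F \subset elt l]]]%SET.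

Definition boundary_facets : {set {set 'I_(nvert M)}} :=
  [set F in facets | `[< hull F (@vert _ _ M) `<=` boundary Om >]]%SET.

Definition outward_unit_normal k F (n : 'rV[R]_d) : Prop :=
  [/\ enorm n = 1,
      forall i j, i \in F -> j \in F -> inner (vert i - vert j) n = 0 &
      forall i j, i \in elt k -> j \in F -> inner (vert i - vert j) n <= 0].

Definition valid_facet_data (fd : facet_data M) : Prop :=
  (forall F, F \in facets ->
     F \subset elt (side1 fd F) /\
     outward_unit_normal (side1 fd F) F (normal fd F)) /\
  (forall F, F \in interior_facets ->
     [/\ side1 fd F != side2 fd F, F \subset elt (side2 fd F) &
         0 <= weight fd F <= 1]).

Definition facet_vert F (i : nat) : 'rV[R]_d := [seq vert j | j <- enum F]`_i.

Definition facet_edges F : 'M[R]_(d.-1, d) :=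
  \matrix_i (facet_vert F i.+1 - facet_vert F 0%N).

Definition std_simplex n : set 'rV[R]_n :=
  [set t | (forall i, 0 <= t 0 i) /\ \sum_i t 0 i <= 1].

(* surface integral over a facet, through its affine parametrization
   t |-> a_0 + t E by the reference simplex of R^(d-1), whose area element is
   (det (E E^T))^(1/2); for d = 1 this is the evaluation at the point F *)
Definition facet_int F (g : 'rV[R]_d -> R) : R :=
  Num.sqrt (\det (facet_edges F *m (facet_edges F)^T)) *
  \int[lebesgue_rV R d.-1]_(t in @std_simplex d.-1)
    g (facet_vert F 0%N + t *m facet_edges F).

(* A piecewise function is given by its restrictions to the elements, so that
   its traces on a facet from both sides are available; the polynomials are
   extended to R^d. *)
Definition broken (V : Type) := 'I_(nelt M) -> 'rV[R]_d -> V.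

Definition is_poly (p : nat) (f : 'rV[R]_d -> R) : Prop :=
  exists c : {ffun 'I_d -> 'I_p.+1} -> R, forall x,
    f x = \sum_(a : {ffun 'I_d -> 'I_p.+1} | (\sum_i a i <= p)%N)
            c a * \prod_i x 0 i ^+ a i.

Definition Sp (p : nat) (v : broken R) : Prop := forall k, is_poly p (v k).

(* for (a, b) = (1, N), (1, d), (N, d): the spaces S_p^N, M_p and M_p^N *)
Definition Spmx a b (p : nat) (v : broken 'M[R]_(a, b)) : Prop :=
  forall i j, Sp p (fun k x => v k x i j).

Arguments Spmx {a b}.

(* the function defined by v on the union of the elements; on the interfaces,
   which are negligible, one of the elements is selected *)
Definition assemble (V : zmodType) (v : broken V) (x : 'rV[R]_d) : V :=
  if [pick k | `[< cell k x >]] is Some k then v k x else 0.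

Definition component N (w : broken 'rV[R]_N) (i : 'I_N) : broken R :=
  fun k x => w k x 0 i.

Definition row_component N (psi : broken 'M[R]_(N, d)) (i : 'I_N) :
    broken 'rV[R]_d :=
  fun k x => row i (psi k x).

Definition div (psi : 'rV[R]_d -> 'rV[R]_d) (x : 'rV[R]_d) : R :=
  \sum_i 'D_(delta_mx 0 i) (fun y => psi y 0 i) x.

Definition spd_form (p : nat) (c : broken R -> broken R -> R) : Prop :=
  [/\ forall v w, Sp p v -> Sp p w -> c v w = c w v,
      forall (a : R) v1 v2 w, Sp p v1 -> Sp p v2 -> Sp p w ->
        c (fun k x => a * v1 k x + v2 k x) w = a * c v1 w + c v2 w &
      forall v, Sp p v -> (exists k x, v k x != 0) -> 0 < c v v].

Definition cform N (c : broken R -> broken R -> R)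
    (w v : broken 'rV[R]_N) : R :=
  \sum_i c (component w i) (component v i).

Definition cnorm N (c : broken R -> broken R -> R) (w : broken 'rV[R]_N) : R :=
  Num.sqrt (cform c w w).

Definition intOm (g : 'rV[R]_d -> R) : R :=
  \int[lebesgue_rV R d]_(x in Om) g x.

Definition L2norm a b (g : 'rV[R]_d -> 'M[R]_(a, b)) : R :=
  Num.sqrt (intOm (fun x => enorm (g x) ^+ 2)).

Definition L2norm_facets a b
    (g : {set 'I_(nvert M)} -> 'rV[R]_d -> 'M[R]_(a, b)) : R :=
  Num.sqrt (\sum_(F in interior_facets)
    facet_int F (fun x => enorm (g F x) ^+ 2)).

Definition is_L2_projection N (p : nat) (g : 'rV[R]_d -> 'rV[R]_N)
    (v : broken 'rV[R]_N) : Prop :=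
  Spmx p v /\ forall l : broken 'rV[R]_N, Spmx p l ->
    intOm (fun x => inner (assemble v x) (assemble l x)) =
    intOm (fun x => inner (g x) (assemble l x)).

Variable fd : facet_data M.

Definition jump (mu : broken R) F (x : 'rV[R]_d) : 'rV[R]_d :=
  (mu (side1 fd F) x - mu (side2 fd F) x) *: normal fd F.

Definition jump_vec N (w : broken 'rV[R]_N) F (x : 'rV[R]_d) : 'M[R]_(N, d) :=
  \matrix_i jump (component w i) F x.

Definition jump_flux (psi : broken 'rV[R]_d) F (x : 'rV[R]_d) : R :=
  inner (psi (side1 fd F) x - psi (side2 fd F) x) (normal fd F).

Definition average (mu : broken R) F (x : 'rV[R]_d) : R :=
  (1 - weight fd F) * mu (side1 fd F) x + weight fd F * mu (side2 fd F) x.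

Definition bh (w : broken R) (psi : broken 'rV[R]_d) : R :=
  - (\sum_(F in interior_facets)
       facet_int F (fun x => average w F x * jump_flux psi F x))
  - (\sum_(F in boundary_facets)
       facet_int F (fun x =>
         w (side1 fd F) x * inner (psi (side1 fd F) x) (normal fd F)))
  + \sum_k \int[lebesgue_rV R d]_(x in cell k) (w k x * div (psi k) x).

Definition is_LDG_gradient N (p : nat)
    (zeta : broken 'rV[R]_N -> broken 'M[R]_(N, d)) : Prop :=
  forall v : broken 'rV[R]_N, Spmx p v ->
    Spmx p (zeta v) /\
    forall psi : broken 'M[R]_(N, d), Spmx p psi ->
      intOm (fun x => inner (assemble (zeta v) x) (assemble psi x)) =
      \sum_i bh (component v i) (row_component psi i).

(* local mesh size on an interior facet, and the penalty parameter eta_F for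
   a given value normA of the L^infinity norm of A *)
Definition facet_size (eta : R) F : R :=
  eta^-1 * Num.min (diam (cell (side1 fd F))) (diam (cell (side2 fd F))).

Definition penalty (eta normA : R) F : R := (facet_size eta F)^-1 * normA.

Definition sh (eta normA : R) (w l : broken R) : R :=
  \sum_(F in interior_facets)
    facet_int F (fun x =>
      penalty eta normA F * inner (jump w F x) (jump l F x)).

Definition LDG_step N (D : set 'rV[R]_N) (A : 'rV[R]_N -> 'M[R]_N)
    (f : 'rV[R]_N -> 'rV[R]_N) (s : 'rV[R]_N -> R) (u : 'rV[R]_N -> 'rV[R]_N)
    (p : nat) (eta : R) (c : broken R -> broken R -> R)
    (zeta : broken 'rV[R]_N -> broken 'M[R]_(N, d)) (eps tau : R)
    (rho_old : 'rV[R]_d -> 'rV[R]_N)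
    (w : broken 'rV[R]_N) (sigma : broken 'M[R]_(N, d)) : Prop :=
  [/\ Spmx p w, Spmx p sigma,
      forall phi : broken 'M[R]_(N, d), Spmx p phi ->
        intOm (fun x => inner
          ((A (u (assemble w x)))^T *m hess s (u (assemble w x))
             *m assemble sigma x)
          (assemble phi x)) =
        intOm (fun x => inner
          ((A (u (assemble w x)))^T *m assemble (zeta w) x) (assemble phi x)) &
      forall lam : broken 'rV[R]_N, Spmx p lam ->
        eps * tau * cform c w lam
        + intOm (fun x => inner (u (assemble w x) - rho_old x) (assemble lam x))
        + tau * intOm (fun x => inner
            (A (u (assemble w x)) *m assemble sigma x) (assemble (zeta lam) x))
        + tau * (\sum_i sh eta (Linfty_norm D A)
                   (component w i) (component lam i)) =
        tau * intOm (fun x => inner (f (u (assemble w x))) (assemble lam x))].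

End mesh.

(* Main.v *)
(* Test the scheme with lambda = w and phi = sigma.  The first equation turns
   the flux term into the coercive form of s'' A, where the symmetry of the
   Hessian is used, and the discrete time derivative is bounded below by the
   convexity inequality (u(w) - rho) . w >= s(u(w)) - s(rho).  Since D is not
   assumed convex, the latter is obtained as the tangent inequality of the
   Legendre transform of s, which is convex on the whole space.  In the first
   step the L^2 projection of rho_0 is tested with an element of the discrete
   space only, and can be replaced by rho_0.  The third estimate is the sum of
   the others. *)
Require Import Defs.
From HB Require Import structures.
From mathcomp Require Import all_boot all_order all_algebra.
From mathcomp Require Import all_classical all_reals all_analysis.
From mathcomp Require Import measurable_realfun.
From mathcomp Require Import ring lra.
Set Implicit Arguments.
Unset Strict Implicit.
Unset Printing Implicit Defensive.
Import Order.TTheory GRing.Theory Num.Theory numFieldNormedType.Exports.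
Local Open Scope classical_set_scope.
Local Open Scope ring_scope.

(** Two obstacles shape the proof. The gradient of the Legendre transform is [u], but its
    monotonicity cannot be read off globally from the convexity of [s], whose tangent inequality
    needs whole segments inside [D]. Near a fixed [w], however, [u] takes its values in a ball
    around [u w] contained in [D], so [u] is locally monotone. This already makes the derivative of
    [u] positive semidefinite, and integrating that derivative along segments of the whole space,
    where no constraint remains, gives the global inequality. The other obstacle is integrability,
    required by each use of linearity or monotonicity of the integral, although [s''] may be
    unbounded near the boundary of [D]. A piecewise polynomial [w] is bounded on [Om], and the
    continuous [u] sends a compact box into a compact subset of [D], so [s''] is bounded along
    [u(w)]. Along the initial datum, which may approach the boundary, only [s] itself is integrated,
    and [s] is continuous up to the boundary. *)

(** * The trace inner product of matrices *)

Section inner_product.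
Context (R : realType) (m n : nat).
Implicit Types P Q : 'M[R]_(m, n).

Lemma innerE P Q : inner P Q = \sum_i \sum_j P i j * Q i j.
Proof.
rewrite /inner /mxtrace exchange_big; apply: eq_bigr => j _ /=.
by rewrite mxE; apply: eq_bigr => i _; rewrite mxE mulrC.
Qed.

Lemma innerC P Q : inner P Q = inner Q P.
Proof. by rewrite /inner -mxtrace_tr trmx_mul trmxK. Qed.

Lemma innerDl P1 P2 Q : inner (P1 + P2) Q = inner P1 Q + inner P2 Q.
Proof. by rewrite /inner mulmxDr mxtraceD. Qed.

Lemma innerZl a P Q : inner (a *: P) Q = a * inner P Q.
Proof. by rewrite /inner -scalemxAr mxtraceZ. Qed.

Lemma innerBl P1 P2 Q : inner (P1 - P2) Q = inner P1 Q - inner P2 Q.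
Proof. by rewrite innerDl -[- P2]scaleN1r innerZl mulN1r. Qed.

Lemma innerBr P Q1 Q2 : inner P (Q1 - Q2) = inner P Q1 - inner P Q2.
Proof. by rewrite innerC innerBl !(innerC P). Qed.

Lemma innerZr a P Q : inner P (a *: Q) = a * inner P Q.
Proof. by rewrite innerC innerZl innerC. Qed.

Lemma inner0r P : inner P 0 = 0.
Proof. by rewrite -(subrr P) innerBr subrr. Qed.

Lemma inner_ge0 P : 0 <= inner P P.
Proof.
rewrite innerE; do 2![apply: sumr_ge0 => ? _].
by rewrite -expr2 sqr_ge0.
Qed.

Lemma enorm_sqr P : enorm P ^+ 2 = inner P P.
Proof. by rewrite sqr_sqrtr// inner_ge0. Qed.

Lemma inner_trmxl (A : 'M[R]_m) P Q : inner (A^T *m P) Q = inner P (A *m Q).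
Proof. by rewrite /inner trmx_mul mulmxA. Qed.

End inner_product.

(** Coercivity is assumed for single vectors of R^N; splitting by columns transfers it to the N x d
    matrix [sigma]. *)
Lemma inner_col (R : realType) m n (P Q : 'M[R]_(m, n)) :
  inner P Q = \sum_j inner (col j P) (col j Q).
Proof.
rewrite innerE exchange_big; apply: eq_bigr => j _ /=.
rewrite innerE; apply: eq_bigr => i _.
by rewrite big_ord1 !mxE.
Qed.


Lemma inner_row (R : realType) n (v w : 'rV[R]_n) :
  inner v w = \sum_i v 0 i * w 0 i.
Proof. by rewrite innerE big_ord1. Qed.

Lemma inner_rows (R : realType) m n (P Q : 'M[R]_(m, n)) :
  inner P Q = \sum_i inner (row i P) (row i Q).
Proof.
rewrite innerE; apply: eq_bigr => i _.
by rewrite inner_row; apply: eq_bigr => j _; rewrite !mxE.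
Qed.

(** * Derivatives along lines and the mean value theorem *)

Section derivative_along_line.
Context (R : realType) (n m : nat).

Lemma is_derive_line (W : normedModType R) (F : 'rV[R]_n -> W) x v (t : R) :
  differentiable F (x + t *: v) ->
  is_derive t 1 (fun r : R => F (x + r *: v)) ('d F (x + t *: v) v).
Proof.
move=> dF.
have dl : is_diff t (fun r : R => x + r *: v) (fun r : R => r *: v).
  by apply: is_diff_eq; apply/funext => r /=; rewrite add0r.
have dFx : is_diff (x + t *: v) F ('d F (x + t *: v)) by exact: differentiableP.
have dc : is_diff t (F \o (fun r : R => x + r *: v))
    ('d F (x + t *: v) \o (fun r : R => r *: v)).
  exact: is_diff_comp.
apply: DeriveDef.
  by apply/derivable1_diffP; exact: (@ex_diff _ _ _ _ _ _ _ dc).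
by rewrite deriveE ?(@diff_val _ _ _ _ _ _ _ dc)/= ?scale1r//; exact: (@ex_diff _ _ _ _ _ _ _ dc).
Qed.

Lemma is_derive_line_coord (F : 'rV[R]_n -> 'rV[R]_m) x v (t : R) j :
  differentiable F (x + t *: v) ->
  is_derive t 1 (fun r : R => F (x + r *: v) 0 j)
    ('d F (x + t *: v) v 0 j).
Proof.
move=> dF.
have dcoord : differentiable (fun z : 'rV[R]_m => z 0 j) (F (x + t *: v)).
  exact: differentiable_coord.
have dG : differentiable ((fun z : 'rV[R]_m => z 0 j) \o F) (x + t *: v).
  exact: differentiable_comp.
have := is_derive_line dG; rewrite diff_comp//=.
suff -> : 'd (fun z : 'rV[R]_m => z 0 j) (F (x + t *: v)) =
   (fun z : 'rV[R]_m => z 0 j) :> (_ -> _) by [].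
have lc : linear (fun z : 'rV[R]_m => z 0 j : R).
  by move=> a y z; rewrite !mxE.
pose c := HB.pack (fun z : 'rV[R]_m => z 0 j : R)
  (GRing.isLinear.Build _ _ _ _ _ lc) : {linear 'rV[R]_m -> R}.
by rewrite (diff_lin _ (f := c))//; exact: coord_continuous.
Qed.

End derivative_along_line.

Lemma is_derive_inner (R : realType) n (a b : R -> 'rV[R]_n) (da db : 'rV[R]_n)
    (t : R) :
  (forall i, is_derive t 1 (fun r => a r 0 i) (da 0 i)) ->
  (forall i, is_derive t 1 (fun r => b r 0 i) (db 0 i)) ->
  is_derive t 1 (fun r => inner (a r) (b r)) (inner da (b t) + inner (a t) db).
Proof.
move=> ha hb.
have h i := is_deriveM (ha i) (hb i).
have := is_derive_sum h.
rewrite (_ : \sum_i _ = (fun r => inner (a r) (b r))); last first.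
  by apply/funext => r; rewrite fct_sumE inner_row.
move=> hd; apply: is_derive_eq hd _; rewrite big_split/= addrC; congr (_ + _); rewrite inner_row.
  by apply: eq_bigr => i _; rewrite mulrC.
by [].
Qed.

Lemma MVT_derive (R : realType) (f df : R -> R) (a b : R) : a < b ->
  (forall x, a <= x <= b -> is_derive x 1 f (df x)) ->
  exists2 c, a < c < b & f b - f a = df c * (b - a).
Proof.
move=> ab df_; have [||c] := @MVT R f df a b ab.
- by move=> x; rewrite in_itv/= => /andP[/ltW ax /ltW xb]; apply: df_; rewrite ax.
- apply: derivable_within_continuous => x; rewrite in_itv/= => axb.
  by have := df_ x axb => -[].
by rewrite in_itv/= => ? ?; exists c.
Qed.

(** * Symmetry of the Hessian of a C^2 function *)

Section hessian.
Context (R : realType) (n : nat).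
Implicit Types (f : 'rV[R]_n -> R) (D : set 'rV[R]_n).

Lemma hessE f x i j : hess f x i j = 'd (grad f) x (delta_mx 0 i) 0 j.
Proof. by rewrite /hess /jacobian /lin1_mx mxE. Qed.

Lemma gradE f x : differentiable f x -> forall v, 'd f x v = inner (grad f x) v.
Proof.
move=> df v; rewrite {1}[v]row_sum_delta linear_sum inner_row /=.
by apply: eq_bigr => i _; rewrite linearZ/= mxE deriveE// mulrC.
Qed.

(* Both increments are removed by the mean value theorem, first along e_j and
   then along e_i; the left-hand side is symmetric in (i, j). *)
Lemma second_difference f D x i j : open D -> C2_on D f -> D x ->
  forall e : R, 0 < e -> \forall h \near 0^'+,
    `|(f (x + h *: delta_mx 0 i + h *: delta_mx 0 j)
       - f (x + h *: delta_mx 0 i) - f (x + h *: delta_mx 0 j) + f x)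
      - hess f x i j * h ^+ 2| <= e * h ^+ 2.
Proof.
move=> oD [dfD C1] Dx e e0.
have Dnear : \forall y \near x, D y by exact: open_nbhs_nbhs.
have Hnear : \forall y \near x, `|hess f x i j - hess f y i j| < e.
  have [_ cJ] := C1 x Dx.
  have /cvgrPdist_lt : (fun y => hess f y i j) y @[y --> x] --> hess f x i j.
    apply: (@continuous_comp _ _ _ (fun y => 'J (grad f) y)
      (fun M : 'M[R]_n => M i j)) => //.
    exact: coord_continuous.
  exact.
have [r r0 Br] : exists2 r : R, 0 < r & forall y, ball x r y ->
    D y /\ `|hess f x i j - hess f y i j| < e.
  have /nbhs_ballP[r /= r0 Br] :
    nbhs x (fun y => D y /\ `|hess f x i j - hess f y i j| < e).
    exact: filterI.
  by exists r => // y /Br.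
near=> h.
have h0 : 0 < h by near: h; exact: nbhs_right_gt.
(* The ball is that of the max norm; for [i = j] both increments move the same coordinate, whence
   twice [h]. *)
have hr : h + h < r.
  have : h < r / 2 by near: h; apply: nbhs_right_lt; rewrite divr_gt0.
  lra.
have small a b : 0 <= a <= h -> 0 <= b <= h ->
    ball x r (x + a *: delta_mx 0 i + b *: delta_mx 0 j).
  move=> /andP[a0 ah] /andP[b0 bh].
  split => // k l; rewrite /ball/= !mxE.
  rewrite -addrA opprD addNKr normrN.
  have le1 (c : R) (d : bool) : 0 <= c <= h -> `|c * d%:R| <= h.
    move=> /andP[c0 ch]; case: d; rewrite ?mulr1 ?mulr0 ?normr0; first by rewrite ger0_norm.
    exact: ltW.
  apply: le_lt_trans hr; apply: le_trans (ler_normD _ _) _.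
  by apply: lerD; apply: le1; apply/andP.
have h00 : 0 <= h <= h by rewrite lexx ltW.
have z00 : 0 <= (0:R) <= h by rewrite lexx ltW.
pose g (t : R) := f (x + h *: delta_mx 0 i + t *: delta_mx 0 j)
                  - f (x + t *: delta_mx 0 j).
have dfE y : D y -> 'd f y (delta_mx 0 j) = grad f y 0 j.
  by move=> Dy; rewrite mxE deriveE//; exact: dfD.
have dg t : 0 <= t <= h -> is_derive t 1 g
    (grad f (x + h *: delta_mx 0 i + t *: delta_mx 0 j) 0 j
     - grad f (x + t *: delta_mx 0 j) 0 j).
  move=> th; have D1 := (Br _ (small h t h00 th)).1.
  have D0 : D (x + t *: delta_mx 0 j).
    by have := (Br _ (small 0 t z00 th)).1; rewrite scale0r addr0.
  rewrite -!dfE//; apply: is_deriveB; apply: is_derive_line; exact: dfD.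
have [b /andP[b0 bh] gh] := MVT_derive h0 dg.
have bb : 0 <= b <= h by rewrite !ltW.
pose k (t : R) := grad f (x + b *: delta_mx 0 j + t *: delta_mx 0 i) 0 j.
have Bk t : 0 <= t <= h -> ball x r (x + b *: delta_mx 0 j + t *: delta_mx 0 i).
  by move=> th; rewrite addrAC; exact: small.
have dk t : 0 <= t <= h -> is_derive t 1 k
    (hess f (x + b *: delta_mx 0 j + t *: delta_mx 0 i) i j).
  move=> th; rewrite hessE; apply: is_derive_line_coord.
  exact: (C1 _ (Br _ (Bk t th)).1).1.
have [a /andP[a0 ah] kh] := MVT_derive h0 dk.
have aa : 0 <= a <= h by rewrite !ltW.
have -> : f (x + h *: delta_mx 0 i + h *: delta_mx 0 j)
       - f (x + h *: delta_mx 0 i) - f (x + h *: delta_mx 0 j) + f x = g h - g 0.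
  by rewrite /g !scale0r !addr0; ring.
move: kh; rewrite /k scale0r addr0 gh (addrAC x (h *: _)) !subr0 => ->.
rewrite -mulrA -expr2 -mulrBl normrM (ger0_norm (sqr_ge0 h)).
rewrite ler_pM2r ?exprn_gt0// distrC ltW//.
by have [_] := Br _ (Bk a aa).
Unshelve. all: by end_near. Qed.

(** For one small [h], the same second difference is within [e / 2 * h ^+ 2] of the two mixed
    derivatives times [h ^+ 2]; after division by [h ^+ 2] they differ by at most the arbitrary
    [e]. *)
Lemma hess_sym f D x : open D -> C2_on D f -> D x -> (hess f x)^T = hess f x.
Proof.
move=> oD C2 Dx; apply/matrixP => i j; rewrite mxE.
apply/eqP; rewrite -subr_eq0 -normr_le0; apply/ler_addgt0Pr => e e0.
rewrite add0r.
have e2 : 0 < e / 2 by rewrite divr_gt0.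
have [h [h0 Hij Hji]] : exists h : R, [/\ 0 < h,
   `|(f (x + h *: delta_mx 0 i + h *: delta_mx 0 j)
       - f (x + h *: delta_mx 0 i) - f (x + h *: delta_mx 0 j) + f x)
      - hess f x i j * h ^+ 2| <= e / 2 * h ^+ 2 &
   `|(f (x + h *: delta_mx 0 j + h *: delta_mx 0 i)
       - f (x + h *: delta_mx 0 j) - f (x + h *: delta_mx 0 i) + f x)
      - hess f x j i * h ^+ 2| <= e / 2 * h ^+ 2].
  near (0:R)^'+ => h; exists h; split.
  - by near: h; exact: nbhs_right_gt.
  - by near: h; exact: (second_difference i j oD C2 Dx e2).
  - by near: h; exact: (second_difference j i oD C2 Dx e2).
have h2 : 0 < h ^+ 2 by rewrite exprn_gt0.
rewrite -(ler_pM2r h2) -[in X in X <= _](ger0_norm (ltW h2)) -normrM.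
move: Hij Hji; rewrite (addrAC x (h *: delta_mx 0 j)).
move: (f _) (f _) (f _) (f _) => A B C E; rewrite !ler_norml => /andP[??] /andP[??].
by apply/andP; split; lra.
Unshelve. all: by end_near. Qed.

End hessian.

(** * Convexity of the entropy and monotonicity of its inverse gradient *)

Section legendre.
Context (R : realType) (n : nat) (D : set 'rV[R]_n).
Context (s : 'rV[R]_n -> R) (u : 'rV[R]_n -> 'rV[R]_n).

(** For [0 < h < 1], convexity bounds the difference quotient at [y] in the direction [x - y] by
    [s x - s y]; the derivative is its limit from the right. The segment has to lie in [D] by
    hypothesis, [D] being possibly nonconvex. *)
Lemma convex_tangent x y : convex_fun_on D s ->
  (forall t : R, 0 <= t <= 1 -> D (t *: x + (1 - t) *: y)) ->
  differentiable s y -> inner (grad s y) (x - y) <= s x - s y.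
Proof.
move=> cs Dxy ds; rewrite -gradE// -deriveE//.
have Dx : D x by have := Dxy 1; rewrite subrr scale0r scale1r addr0; apply; rewrite ler01 lexx.
have Dy : D y by have := Dxy 0; rewrite subr0 scale0r scale1r add0r; apply; rewrite ler01 lexx.
have /cvg_dnbhs_at_right c : derivable s y (x - y) by exact: diff_derivable.
apply: (cvgr_to_le c); near=> h.
have h0 : 0 < h by near: h; exact: nbhs_right_gt.
have h1 : h < 1 by near: h; exact: nbhs_right_lt.
have h01 : 0 <= h <= 1 by rewrite !ltW.
rewrite /GRing.scale/= mulrC ler_pdivrMr// lerBlDr.
have -> : h *: (x - y) + y = h *: x + (1 - h) *: y.
  by rewrite scalerBr scalerBl scale1r -!addrA (addrC y).
apply: (le_trans (cs _ _ _ Dx Dy h01 (Dxy _ h01))); rewrite le_eqVlt; apply/orP; left.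
by apply/eqP; ring.
Unshelve. all: by end_near. Qed.

Lemma segment_ball (x y z : 'rV[R]_n) (r t : R) :
  ball z r x -> ball z r y -> 0 <= t <= 1 -> ball z r (t *: x + (1 - t) *: y).
Proof.
move=> [r0 xr] [_ yr] /andP[t0 t1]; split => // i j.
have := xr i j; have := yr i j; rewrite /ball/= !mxE.
move: (x i j) (y i j) (z i j) => a b c bc ac.
have -> : c - (t * a + (1 - t) * b) = t * (c - a) + (1 - t) * (c - b) by ring.
apply: le_lt_trans (ler_normD _ _) _; rewrite !normrM (ger0_norm t0) (@ger0_norm _ (1 - t)); last lra.
have [->|t00] := eqVneq t 0; first by rewrite mul0r add0r subr0 mul1r.
have tp : 0 < t by rewrite lt_def t00.
have h1 : t * `|c - a| < t * r by rewrite ltr_pM2l.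
have h2 : (1 - t) * `|c - b| <= (1 - t) * r by apply: ler_wpM2l; [lra|exact: ltW].
by lra.
Qed.

Hypotheses (oD : open D) (ds : forall x, D x -> differentiable s x)
  (cs : convex_fun_on D s) (du : forall w, differentiable u w)
  (uD : forall w, D (u w)) (su : forall w, grad s (u w) = w).

(** The tangent inequalities at [u w] and at [u v], whose gradients are [w] and [v], add up to the
    claim. Both need the segment between [u w] and [u v] inside [D], which is secured by taking
    [u v] in a ball around [u w], hence the restriction to [v] near [w]. *)
Lemma u_locally_monotone w :
  \forall v \near w, 0 <= inner (u v - u w) (v - w).
Proof.
have /nbhs_ballP[r /= r0 Br] : nbhs (u w) D by exact: open_nbhs_nbhs.
have cu : u v @[v --> w] --> u w by exact: differentiable_continuous (du w).
near=> v.
have uv : ball (u w) r (u v) by near: v; apply: cu; exact: nbhsx_ballx.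
have uw : ball (u w) r (u w) by exact: ballxx.
have h1 := @convex_tangent (u v) (u w) cs
  (fun t th => Br _ (segment_ball uv uw th)) (ds (uD w)).
have h2 := @convex_tangent (u w) (u v) cs
  (fun t th => Br _ (segment_ball uw uv th)) (ds (uD v)).
rewrite !su in h1 h2.
have h3 : inner w (u v - u w) + inner v (u w - u v) <= 0 by lra.
rewrite innerBr innerC [in X in _ - X]innerC subr_ge0.
have uvw : u w - u v = -1 *: (u v - u w) by rewrite scaleN1r opprB.
by move: h3; rewrite uvw innerZr; lra.
Unshelve. all: by end_near. Qed.

(** Local monotonicity is enough, since the derivative is a limit over small [h]: the difference
    quotient equals [h ^- 2] times the pairing of [u (w + h *: v) - u w] with [h *: v]. *)
Lemma derive_u_ge0 w v : 0 <= inner ('d u w v) v.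
Proof.
have dl : is_derive (0:R) 1 (fun t : R => inner (u (w + t *: v)) v)
    (inner ('d u w v) v).
  have h i : is_derive (0:R) 1 (fun r : R => u (w + r *: v) 0 i) ('d u w v 0 i).
    have := @is_derive_line_coord _ _ _ u w v 0 i.
    by rewrite scale0r addr0; apply; exact: du.
  have := @is_derive_inner _ _ _ (cst v) _ 0 _ h.
  rewrite inner0r addr0; apply => i.
  by rewrite mxE; exact: is_derive_cst.
have [cv <-] := dl; apply: limr_ge => //.
have /nbhs_ballP[r /= r0 Br] := u_locally_monotone w.
have nz : \forall h \near (0:R)^', h != 0 by exact: nbhs_dnbhs_neq.
have cl : (fun h : R => w + h *: v) x @[x --> (0:R)^'] --> w.
  have : (fun h : R => w + h *: v) x @[x --> (0:R)] --> w + (0:R) *: v.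
    apply: cvgD; first exact: cvg_cst.
    by apply: cvgZr_tmp; exact: cvg_id.
  by rewrite scale0r addr0; exact: cvg_within_filter.
near=> h.
have h0 : h != 0 by near: h.
have bh : ball w r (w + h *: v) by near: h; exact: (cl _ (nbhsx_ballx w r r0)).
have := Br _ bh => /=; rewrite (addrAC w) subrr add0r innerZr innerBl => p.
rewrite addr0 scale0r addr0 /GRing.scale/= mulr1.
rewrite -[X in _ * X](mulKf h0) mulrA mulr_ge0//.
by rewrite -expr2 sqr_ge0.
Unshelve. all: by end_near. Qed.

(* D need not be convex, so this is not the tangent inequality of [s]: it is
   the one of the Legendre transform [w |-> u w . w - s (u w)], which is convex
   on the whole space because its gradient [u] is monotone. *)
Lemma entropy_tangent w0 w1 :
  inner w1 (u w0 - u w1) <= s (u w0) - s (u w1).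
Proof.
pose v := w1 - w0.
have dut (t : R) i := is_derive_line_coord i (du (w0 + t *: v)).
pose G (t : R) := inner (u (w0 + t *: v)) v.
have dG (t : R) : is_derive t 1 G (inner ('d u (w0 + t *: v) v) v).
  have := @is_derive_inner _ _ _ (cst v) _ 0 _ (dut t).
  rewrite inner0r addr0; apply => i.
  by apply: is_derive_eq (is_derive_cst _ _ _) _; rewrite mxE.
(* The Legendre transform along the segment from [w0] to [w1]. As the gradient of [s] at [u w] is
   [w], the two terms containing ['d u] cancel in [F'] and leave [G]. *)
pose F (t : R) := inner (u (w0 + t *: v)) (w0 + t *: v) - s (u (w0 + t *: v)).
have dF (t : R) : is_derive t 1 F (G t).
  have did i : is_derive t 1 (fun r : R => (w0 + r *: v) 0 i) (v 0 i).
    by have := @is_derive_line_coord _ _ _ id w0 v t i (@ex_diff _ _ _ _ _ _ _ (is_diff_id _));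
    rewrite (@diff_val _ _ _ _ _ _ _ (is_diff_id _)).
  have dsu : is_derive t 1 (fun r : R => s (u (w0 + r *: v)))
      (inner (w0 + t *: v) ('d u (w0 + t *: v) v)).
    have dsut : differentiable (s \o u) (w0 + t *: v).
      by apply: differentiable_comp; [exact: du|exact/ds/uD].
    have := is_derive_line dsut.
    by rewrite diff_comp/= ?gradE ?su//; first [exact: du|exact/ds/uD].
  apply: is_derive_eq (is_deriveB (is_derive_inner (dut t) did) dsu) _.
  by rewrite [X in _ - X]innerC addrAC subrr add0r.
(* [F 1 - F 0 = G c >= G 0] is the tangent inequality of the transform at [w0]; rearranged, it is
   the claim. *)
have [c /andP[c0 _] Fc] := MVT_derive ltr01 (fun t _ => dF t).
have [b _ Gb] := MVT_derive c0 (fun t _ => dG t).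
have Gc : G 0 <= G c.
  by rewrite -subr_ge0 Gb mulr_ge0 ?subr0 ?(ltW c0)//; exact: derive_u_ge0.
move: Gc; rewrite -[G c]mulr1 -[X in G c * X]subr0 -Fc /G /F scale0r addr0 scale1r.
have -> : w0 + v = w1 by rewrite /v addrC subrK.
rewrite /v !innerBr (innerC w1) (innerC w1 (u w1)); lra.
Qed.

End legendre.

(** * Insensitivity of integrals to null sets, without measurability of the integrand *)

Section integral_negligible.
Local Open Scope ereal_scope.
Context d (T : measurableType d) (R : realType).
Variable mu : {measure set T -> \bar R}.
Import HBNNSimple.

(** A simple function below [f] is cut off to zero on [N]: its integral is unchanged, and it is now
    below [g], on [N] because [g] is nonnegative. *)
Lemma ereal_sup_sintegral_negligible (N : set T) (f g : T -> \bar R) :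
  measurable N -> mu N = 0 -> (forall x, 0 <= g x) ->
  (forall x, ~ N x -> f x = g x) ->
  ereal_sup [set sintegral mu h |
    h in [set h : {nnsfun T >-> R} | forall x, (h x)%:E <= f x]] <=
  ereal_sup [set sintegral mu h |
    h in [set h : {nnsfun T >-> R} | forall x, (h x)%:E <= g x]].
Proof.
move=> mN N0 g0 fg; apply: ub_ereal_sup => _ [h hf <-].
have mNC : measurable (~` N) by exact: measurableC.
have hE x : proj_nnsfun h mNC x = (h \_ (~` N)) x by rewrite (mrestrict h mNC).
apply: ereal_sup_ubound; exists (proj_nnsfun h mNC).
  move=> x; rewrite hE patchE; case: ifPn => [/[!inE] xN|//].
  by rewrite -fg.
have intN (k : {nnsfun T >-> R}) :
    sintegral mu k = \int[mu]_(x in setT `\` N) (k x)%:E.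
  rewrite -integralT_nnsfun (ge0_negligible_integral mN)//.
  - by apply/measurable_EFinP; exact: measurable_funP.
  - by move=> x _; rewrite lee_fin.
rewrite !intN.
apply: eq_integral => x; rewrite inE => -[_ Nx].
by rewrite hE patchE mem_set.
Qed.

(* The integral of a nonmeasurable nonnegative function is a lower integral in
   the library.  This case matters for s o rho_0, which need not be Borel on
   the null set where rho_0 leaves D. *)
Lemma integral_eq_off_negligible (D N : set T) (f g : T -> \bar R) :
  measurable N -> mu N = 0 -> (forall x, D x -> ~ N x -> f x = g x) ->
  \int[mu]_(x in D) f x = \int[mu]_(x in D) g x.
Proof.
move=> mN N0 fg.
have fgD x : ~ N x -> (f \_ D) x = (g \_ D) x.
  by move=> Nx; rewrite !patchE; case: ifPn => //; rewrite inE => /fg ->.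
rewrite /integral; congr (_ - _); apply/eqP; rewrite eq_le; apply/andP; split;
  apply: (ereal_sup_sintegral_negligible mN N0) => // x Nx;
  by rewrite ?funeposE ?funenegE fgD.
Qed.

End integral_negligible.

(** * Open sets and continuous functions for the coordinate sigma-algebra *)

Section rV_borel.
Context (R : realType).

Lemma measurable_fun_rV n d (T : measurableType d) (X : set T)
    (f : T -> 'rV[R]_n) : measurable X ->
  (forall i, measurable_fun X (fun x => f x 0 i : measurableTypeR R)) ->
  measurable_fun X f.
Proof.
move=> mX mf; apply: measurability; first reflexivity.
move=> _ [C + <-].
rewrite -bigcup_seq/= => -[i _ [B mB <-]].
by rewrite setTI; exact: mf.
Qed.

Lemma measurable_coord_ball n (x : 'rV[R]_n) (r : R) :
  measurable [set y : 'rV[R]_n | forall i, ball (x 0 i) r (y 0 i)].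
Proof.
rewrite (_ : [set _ | _] = \bigcap_(i in [set: 'I_n])
    ((fun y : 'rV[R]_n => y 0 i) @^-1` ball (x 0 i) r)); last first.
  by apply/seteqP; split => [y yb i _|y yb i]; [exact: yb|exact: (yb i Logic.I)].
apply: fin_bigcap_measurable => // i _.
rewrite -[X in measurable X]setTI; apply: measurable_coor => //.
exact: measurable_ball.
Qed.

(** The sigma-algebra is generated by the coordinates and not by the topology, so [U] is written as
    the countable union of the boxes with rational centre and radius [1/(k+1)] that it contains. *)
Lemma open_measurable_rV n (U : set 'rV[R]_n) : open U -> measurable U.
Proof.
move=> oU.
pose B (p : 'rV[rat]_n * nat) : set 'rV[R]_n :=
  [set y | forall i, ball (ratr (p.1 0 i) : R) (p.2.+1%:R^-1) (y 0 i)].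
pose F p := if `[< B p `<=` U >] then B p else set0.
have -> : U = \bigcup_p F p.
  apply/seteqP; split => [x Ux|x [p _]]; last first.
    by rewrite /F; case: asboolP => // BU /BU.
  have /nbhs_ballP[r /= r0 Br] : nbhs x U by exact: open_nbhs_nbhs.
  (* Twice the radius: [x] and the other points of the box are each within [1/(k+1)] of the rational
     centre. *)
  have [k kr] : exists k : nat, k.+1%:R^-1 + k.+1%:R^-1 < r.
    have [k _ hk] := near_infty_natSinv_lt (PosNum (divr_gt0 r0 (ltr0n R 2))).
    have /= := hk k (leqnn k) => h; exists k.
    by rewrite [ltRHS](splitr r) ltrD.
  have e0 : 0 < k.+1%:R^-1 :> R by rewrite invr_gt0.
  have /choice[q qx] (i : 'I_n) : exists q : rat, ball (x 0 i) k.+1%:R^-1 (ratr q : R).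
    have [||z [/= xz [q _ qz]]] := @dense_rat R (ball (x 0 i) k.+1%:R^-1).
    - by exists (x 0 i); exact: ballxx.
    - exact: ball_open.
    by exists q; rewrite qz.
  have qB y : B (\row_i q i, k) y -> U y.
    move=> By; apply: Br; split => // a b; rewrite ord1.
    have := By b; rewrite mxE => yb; apply: le_ball (ltW kr) _ _.
    exact: ball_triangle (qx b) yb.
  exists (\row_i q i, k) => //; rewrite /F asboolT// => i.
  by rewrite mxE; exact: ball_sym.
apply: countable_bigcupT_measurable => [|p]; first exact: countableP.
rewrite /F; case: asboolP => // _.
have := @measurable_coord_ball n (\row_i ratr (p.1 0 i)) (p.2.+1%:R^-1).
by under eq_set do under eq_forall do rewrite mxE.
Qed.

Lemma closed_measurable_rV n (U : set 'rV[R]_n) : closed U -> measurable U.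
Proof.
move=> cU; rewrite -[U]setCK; apply: measurableC; apply: open_measurable_rV.
exact: closed_openC.
Qed.

(** Continuity of [g] on the open set [D] containing the values of [f] suffices, as the part of [D]
    where [g] exceeds [r] is open. This covers [s], about which nothing is known outside the closure
    of [D]. *)
Lemma measurable_continuous_comp n d (T : measurableType d) (X : set T)
    (D : set 'rV[R]_n) (f : T -> 'rV[R]_n) (g : 'rV[R]_n -> R) :
  measurable X -> (forall i, measurable_fun X (fun x => f x 0 i : measurableTypeR R)) ->
  open D -> (forall x, X x -> D (f x)) ->
  (forall y, D y -> {for y, continuous g}) ->
  measurable_fun X (g \o f).
Proof.
move=> mX /(measurable_fun_rV mX) mf oD fD cg.
apply: (measurability _ (RGenOInfty.measurableE R)).
move=> _ [_ [r ->] <-].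
have oDr : open (D `&` [set y | r < g y]).
  rewrite openE => y [Dy ry]; apply: filterI; first exact: open_nbhs_nbhs.
  by have := cg y Dy; move/(cvgr_gt _); exact.
have -> : X `&` (g \o f) @^-1` `]r, +oo[ = X `&` f @^-1` (D `&` [set y | r < g y]).
  apply/seteqP; split => x [Xx /=]; rewrite in_itv/= andbT => h; split => //=.
    by split => //; exact: fD.
  by case: h.
by apply: mf => //; exact: open_measurable_rV.
Qed.

End rV_borel.

(** * Finiteness of the Lebesgue measure of bounded sets *)

Section finite_measure.
Context (R : realType).

Lemma le_coord_norm n (x : 'rV[R]_n) i : `|x 0 i| <= `|x|.
Proof.
rewrite -[`|x|]/(mx_norm x) mx_normrE.
exact: (le_bigmax _ (fun ij : 'I_1 * 'I_n => `|x ij.1 ij.2|) (0, i)).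
Qed.

Lemma measurable_box n (M : R) :
  measurable [set x : 'rV[R]_n | forall i, `|x 0 i| <= M].
Proof.
rewrite (_ : [set _ | _] = \bigcap_(i in [set: 'I_n])
  ((fun y : 'rV[R]_n => y 0 i) @^-1` `[- M, M])); last first.
  apply/seteqP; split => [y yb i _|y yb i]; first by rewrite /= in_itv/= -ler_norml.
  by have /= := yb i Logic.I; rewrite in_itv/= -ler_norml.
apply: fin_bigcap_measurable => // i _.
by rewrite -[X in measurable X]setTI; apply: measurable_coor.
Qed.

(** Induction along the recursive construction of the measure: the preimage of a box under [cons_rV]
    is an interval times a box of one dimension less. Dimension 0 carries a Dirac mass. *)
Lemma lebesgue_rV_box n (M : R) :
  (lebesgue_rV R n [set x : 'rV[R]_n | forall i, `|x 0 i| <= M]%R < +oo)%E.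
Proof.
elim: n => [|n IH] /=; first by rewrite diracE ltry.
rewrite /lebesgue_step /pushforward.
rewrite (_ : _ @^-1` _ = `[- M, M] `*` [set x : 'rV[R]_n | forall i, `|x 0 i| <= M]); last first.
  apply/seteqP; split => [[a v] /= h|[a v] [/= + h] i].
    split; first by have := h ord0; rewrite mxE unlift_none /= in_itv/= ler_norml.
    by move=> i; have := h (lift ord0 i); rewrite mxE liftK /=.
  rewrite in_itv/= -ler_norml => aM.
  by case: (unliftP ord0 i) => [j ->|->]; rewrite mxE ?liftK ?unlift_none//=.
rewrite product_measure1E//; last exact: measurable_box.
rewrite lte_mul_pinfty//.
  rewrite ge0_fin_numE//; have /= -> := lebesgue_measure_itv (`[- M, M]%R).
  by case: ifPn => _; rewrite ?ltry.
Qed.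

Lemma bounded_set_box n (X : set 'rV[R]_n) : bounded_set X ->
  exists M : R, forall x, X x -> forall i, `|x 0 i| <= M.
Proof.
move=> /pinfty_ex_gt0[M _ XM]; exists M => x Xx i.
by apply: le_trans (le_coord_norm _ _) _; exact: XM.
Qed.

Lemma lebesgue_rV_bounded n (X : set 'rV[R]_n) : measurable X -> bounded_set X ->
  (lebesgue_rV R n X < +oo)%E.
Proof.
move=> mX /bounded_set_box[M XM].
apply: le_lt_trans (lebesgue_rV_box n M).
by apply: le_measure; rewrite ?inE//; exact: measurable_box.
Qed.

End finite_measure.

(** * Bounded measurable functions *)

Section bounded_measurable.
Context d (T : measurableType d) (R : realType) (X : set T).
Hypothesis mX : measurable X.

(** Unlike integrability, this property is stable under products and under composition with
    continuous functions, and it implies integrability on sets of finite measure. *)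
Definition bounded_measurable (h : T -> R) : Prop :=
  measurable_fun X h /\ exists C, forall x, X x -> `|h x| <= C.

Lemma bounded_measurable_cst (a : R) : bounded_measurable (fun=> a).
Proof. by split; [exact: measurable_cst|exists `|a|]. Qed.

Lemma bounded_measurableD f g : bounded_measurable f -> bounded_measurable g ->
  bounded_measurable (fun x => f x + g x).
Proof.
move=> [mf [a fa]] [mg [b gb]]; split; first exact: measurable_funD.
exists (a + b) => x Xx; apply: le_trans (ler_normD _ _) _.
by apply: lerD; [exact: fa|exact: gb].
Qed.

Lemma bounded_measurableM f g : bounded_measurable f -> bounded_measurable g ->
  bounded_measurable (fun x => f x * g x).
Proof.
move=> [mf [a fa]] [mg [b gb]]; split; first exact: measurable_funM.
exists (a * b) => x Xx; rewrite normrM.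
by apply: ler_pM => //; [exact: fa|exact: gb].
Qed.

Lemma bounded_measurableB f g : bounded_measurable f -> bounded_measurable g ->
  bounded_measurable (fun x => f x - g x).
Proof.
move=> bf bg; rewrite (_ : (fun x => _) = (fun x => f x + (-1) * g x)).
  by apply: bounded_measurableD => //; apply: bounded_measurableM => //;
     exact: bounded_measurable_cst.
by apply/funext => x; rewrite mulN1r.
Qed.

Lemma bounded_measurable_sum (I : Type) (r : seq I) (P : pred I) (f : I -> T -> R) :
  (forall i, P i -> bounded_measurable (f i)) ->
  bounded_measurable (fun x => \sum_(i <- r | P i) f i x).
Proof.
move=> bf; elim: r => [|i r IH].
  rewrite (_ : (fun x => _) = fun=> 0); first exact: bounded_measurable_cst.
  by apply/funext => x; rewrite big_nil.
rewrite (_ : (fun x => _) = fun x => if P i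
    then f i x + \sum_(j <- r | P j) f j x else \sum_(j <- r | P j) f j x).
  by case Pi : (P i) => //; apply: bounded_measurableD => //; exact: bf.
by apply/funext => x; rewrite big_cons.
Qed.

Lemma bounded_measurable_indic (S : set T) : measurable S ->
  bounded_measurable (\1_S : T -> R).
Proof.
move=> mS; split; first exact: measurable_indic.
by exists 1 => x _; rewrite indicE; case: (_ \in _); rewrite ?normr1 ?normr0.
Qed.

Lemma bounded_measurable_integrable (mu : {measure set T -> \bar R}) (h : T -> R) :
  (mu X < +oo)%E -> bounded_measurable h -> mu.-integrable X (EFin \o h).
Proof.
move=> Xoo [mh [C hC]]; apply: measurable_bounded_integrable => //.
exists C; split; first exact: num_real.
by move=> y Cy x Xx /=; apply: le_trans (hC x Xx) (ltW Cy).
Qed.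

Lemma bounded_measurable_inner m n (P Q : T -> 'M[R]_(m, n)) :
  (forall i j, bounded_measurable (fun x => P x i j)) ->
  (forall i j, bounded_measurable (fun x => Q x i j)) ->
  bounded_measurable (fun x => inner (P x) (Q x)).
Proof.
move=> bP bQ; rewrite (funext (fun x => innerE (P x) (Q x))).
apply: bounded_measurable_sum => i _; apply: bounded_measurable_sum => j _.
exact: bounded_measurableM.
Qed.

Lemma bounded_measurable_mulmx m n p (P : T -> 'M[R]_(m, n)) (Q : T -> 'M[R]_(n, p)) :
  (forall i j, bounded_measurable (fun x => P x i j)) ->
  (forall i j, bounded_measurable (fun x => Q x i j)) ->
  forall i j, bounded_measurable (fun x => (P x *m Q x) i j).
Proof.
move=> bP bQ i j; rewrite (funext (fun x => mxE _ _ i j)).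
by apply: bounded_measurable_sum => k _; exact: bounded_measurableM.
Qed.

(** The function [g] may be unbounded, but the values of [v] on [X] stay in a compact box, on which
    [g] is bounded. *)
Lemma bounded_measurable_comp n (v : T -> 'rV[R]_n) (g : 'rV[R]_n -> R) :
  continuous g -> (forall i, bounded_measurable (fun x => v x 0 i)) ->
  bounded_measurable (g \o v).
Proof.
move=> cg bv; split.
  apply: (@measurable_continuous_comp _ _ _ _ _ setT) => //.
  - by move=> i; have [] := bv i.
  - exact: openT.
  - by move=> y _; exact: cg.
have /choice[C vC] i := (bv i).2.
pose K := [set z : 'rV[R]_n | forall i, `[- C i, C i]%classic (z 0 i)].
have cK : compact K.
  apply: (@rV_compact R n (fun i => `[- C i, C i]%classic)) => i.
  exact: segment_compact.
have /compact_bounded/pinfty_ex_gt0[B _ gB] : compact (g @` K).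
  by apply: continuous_compact => //; exact: continuous_subspaceT.
exists B => x Xx; have : (g @` K) (g (v x)); last exact: gB.
exists (v x) => // i.
by rewrite /= in_itv/= -ler_norml; exact: vC.
Qed.

End bounded_measurable.

(** * Measurability of cells and piecewise polynomials, and facet integrals *)

Section mesh_functions.
Context (R : realType).

Lemma continuous_sumr (T : topologicalType) (I : Type) (r : seq I) (P : pred I)
    (V : normedModType R) (F : I -> T -> V) :
  (forall i, P i -> continuous (F i)) ->
  continuous (fun x => \sum_(i <- r | P i) F i x).
Proof. by move=> cF; apply: continuous_big => //; exact: add_continuous. Qed.

(** A hull is closed, being the continuous image of a compact set of barycentric weights. *)
Lemma hull_measurable n m (P : {set 'I_m}) (x : 'I_m -> 'rV[R]_n) :
  measurable (hull P x).
Proof.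
apply: closed_measurable_rV; apply: compact_closed; first exact: norm_hausdorff.
pose phi (l : 'rV[R]_m) : 'rV[R]_n := \sum_(i in P) l 0 i *: x i.
pose sum1 := [set l : 'rV[R]_m | \sum_(i in P) l 0 i = 1].
pose box := [set l : 'rV[R]_m | forall i, `[0, 1]%classic (l 0 i)].
have -> : hull P x = phi @` (box `&` sum1).
  apply/seteqP; split => [y [l [l0 l1 ->]]|_ [l [lb l1] <-]]; last first.
    exists (fun i => l 0 i); split => // i.
    by have /= := lb i; rewrite in_itv/= => /andP[].
  (* The weights outside [P] are not bounded above in [hull]; setting them to 0 puts the weights in
     the compact unit box. *)
  exists (\row_i (if i \in P then l i else 0)); last first.
    by apply: eq_bigr => i iP; rewrite mxE iP.
  split => [i|]; last by rewrite /sum1/= -l1; apply: eq_bigr => i iP; rewrite mxE iP.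
  rewrite /= in_itv/= mxE; case: ifPn => iP; last by rewrite lexx ler01.
  by rewrite l0/= -l1 (bigD1 i)//= lerDl sumr_ge0.
apply: continuous_compact.
  apply: continuous_subspaceT; apply: continuous_sumr => i _ l.
  exact: (@cvgZr_tmp R _ _ (nbhs l) _ (fun l : 'rV[R]_m => l 0 i) (l 0 i) (x i)
    (@coord_continuous R 1 m 0 i l)).
apply: compact_closedI.
  by apply: (@rV_compact R m (fun=> `[0, 1]%classic)) => i; exact: segment_compact.
have -> : sum1 = (fun l : 'rV[R]_m => \sum_(i in P) l 0 i) @^-1` [set 1] by [].
apply: preimage_closed; last exact: closed_eq.
move=> l _; apply: (continuous_sumr (V := R^o)) => i _.
exact: coord_continuous.
Qed.

Lemma is_poly_continuous d p (f : 'rV[R]_d -> R) : is_poly p f -> continuous f.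
Proof.
move=> [c fE]; rewrite (funext fE).
have cm (a : {ffun 'I_d -> 'I_p.+1}) :
    continuous (fun x : 'rV[R]_d => \prod_i x 0 i ^+ a i).
  apply: continuous_big => [|i _ x]; first exact: mul_continuous.
  apply: (continuous_comp (f := fun x : 'rV[R]_d => x 0 i) (g := fun z => z ^+ a i)).
    exact: coord_continuous.
  exact: exprn_continuous.
apply: (continuous_sumr (V := R^o)) => a _ x.
by apply: continuousM; [exact: cst_continuous|exact: cm].
Qed.

Lemma bounded_measurable_coor n (X : set 'rV[R]_n) i : bounded_set X ->
  bounded_measurable X (fun x : 'rV[R]_n => x 0 i).
Proof.
move=> /bounded_set_box[C XC]; split; last by exists C => x Xx; exact: XC.
by apply: measurable_funS (@measurable_coor R n i).
Qed.

Lemma bounded_measurable_continuous n (X : set 'rV[R]_n) (g : 'rV[R]_n -> R) :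
  measurable X -> bounded_set X -> continuous g -> bounded_measurable X g.
Proof.
move=> mX bX cg; apply: (bounded_measurable_comp mX (v := id)) => // i.
exact: bounded_measurable_coor.
Qed.

(** Cells overlap on interfaces, so the set [S k] where the cell [k] is selected is not the cell
    itself. The selection at [x] depends only on the set [B] of cells containing [x], so [S k] is a
    finite union of the sets [T B] on which [B] is constant. The assembled function is then a finite
    sum of polynomials times indicators. *)
Lemma bounded_measurable_assemble d (M : mesh R d) p a b (X : set 'rV[R]_d)
    (v : broken M 'M[R]_(a, b)) : measurable X -> bounded_set X -> Spmx p v ->
  forall i j, bounded_measurable X (fun x => assemble v x i j).
Proof.
move=> mX bX Sv i j.
pose S (k : 'I_(nelt M)) := [set x | [pick k | `[< @cell R d M k x >]] = Some k].
have mcell (k : 'I_(nelt M)) : measurable (@cell R d M k).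
  exact: (hull_measurable (elt k) (@vert _ _ M)).
have mS k : measurable (S k).
  pose T (B : {set 'I_(nelt M)}) := \bigcap_(l in setT)
    (if l \in B then @cell R d M l else ~` @cell R d M l).
  have -> : S k = \bigcup_(B in [set B : {set 'I_(nelt M)} | [pick l in B] = Some k]) T B.
    apply/seteqP; split => [x Sx|x [B /= Bk TB]]; last first.
      rewrite /S/= -Bk; apply: eq_pick => l; have := TB l Logic.I.
      by rewrite /=; case: ifPn => _ h; [exact: asboolT|exact: asboolF].
    exists [set l | `[< @cell R d M l x >]]%SET => /=.
      by rewrite -Sx; apply: eq_pick => l; rewrite inE.
    by move=> l _; rewrite inE; case: asboolP.
  apply: fin_bigcup_measurable; first exact: finite_finset.
  move=> B _; apply: fin_bigcap_measurable; first exact: finite_finset.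
  by move=> l _; case: ifPn => _; [|apply: measurableC]; exact: mcell.
rewrite (_ : (fun x => _) = fun x => \sum_k \1_(S k) x * v k x i j).
  apply: bounded_measurable_sum => k _; apply: bounded_measurableM => //.
    exact: bounded_measurable_indic.
  by apply: bounded_measurable_continuous => //; apply: is_poly_continuous (Sv i j k).
apply/funext => x; rewrite /assemble; case E : [pick k | _] => [k|].
  rewrite (bigD1 k)//= indicE mem_set// mul1r big1 ?addr0// => l lk.
  rewrite indicE memNset ?mul0r// /S/= E => -[kl].
  by rewrite kl eqxx in lk.
rewrite mxE big1// => l _.
by rewrite indicE memNset ?mul0r// /S/= E.
Qed.

Lemma std_simplex_bounded n : bounded_set (@std_simplex R n).
Proof.
exists 1; split => // y y1 x [x0 x1]; apply: le_trans (ltW y1).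
rewrite -[`|x|]/(mx_norm x) mx_normrE; apply: bigmax_le => // -[i j] _ /=.
rewrite ord1 ger0_norm//; apply: le_trans x1.
by rewrite (bigD1 j)//= lerDl sumr_ge0.
Qed.

Lemma std_simplex_measurable n : measurable (@std_simplex R n).
Proof.
have -> : @std_simplex R n = (\bigcap_(i in [set: 'I_n])
    (fun t : 'rV[R]_n => t 0 i) @^-1` `[0, +oo[) `&`
    (fun t : 'rV[R]_n => \sum_i t 0 i) @^-1` `]-oo, 1].
  apply/seteqP; split => [t [t0 t1]|t [t0 t1]]; split.
  - by move=> i _; rewrite /= in_itv/= t0.
  - by rewrite /= in_itv.
  - by move=> i; have /= := t0 i Logic.I; rewrite in_itv/= andbT.
  - by move: t1; rewrite /= in_itv.
apply: measurableI.
  apply: fin_bigcap_measurable => // i _.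
  by rewrite -[X in measurable X]setTI; apply: measurable_coor.
rewrite -[X in measurable X]setTI.
apply: measurable_sum => //.
by move=> i; exact: measurable_coor.
Qed.

Section facet.
Context d (M : mesh R d) (F : {set 'I_(nvert M)}).

Lemma facet_integrable (g : 'rV[R]_d -> R) : continuous g ->
  (lebesgue_rV R d.-1).-integrable (@std_simplex R d.-1)
    (EFin \o (fun t => g (facet_vert F 0 + t *m facet_edges F))).
Proof.
move=> cg; have mX := @std_simplex_measurable d.-1.
have bX := @std_simplex_bounded d.-1.
apply: bounded_measurable_integrable => //; first exact: lebesgue_rV_bounded.
apply: (bounded_measurable_comp mX) => // i.
rewrite (_ : (fun t => _) = fun t : 'rV[R]_(d.-1) => facet_vert F 0 0 i +
    \sum_k t 0 k * facet_edges F k i); last by apply/funext => t; rewrite !mxE.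
apply: bounded_measurableD => //; first exact: bounded_measurable_cst.
apply: bounded_measurable_sum => k _; apply: bounded_measurableM => //.
  exact: bounded_measurable_coor.
exact: bounded_measurable_cst.
Qed.

Lemma facet_int_ge0 (g : 'rV[R]_d -> R) : (forall x, 0 <= g x) -> 0 <= facet_int F g.
Proof. by move=> g0; rewrite mulr_ge0 ?sqrtr_ge0// Rintegral_ge0. Qed.

Lemma facet_int_sum (I : Type) (r : seq I) (g : I -> 'rV[R]_d -> R) :
  (forall i, continuous (g i)) ->
  facet_int F (fun x => \sum_(i <- r) g i x) = \sum_(i <- r) facet_int F (g i).
Proof.
move=> cg; rewrite /facet_int -mulr_sumr; congr (_ * _).
elim: r => [|i r IH].
  rewrite big_nil (_ : (fun t => _) = fun=> 0) ?Rintegral_cst ?mul0r//.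
    exact: std_simplex_measurable.
  by apply/funext => t; rewrite big_nil.
rewrite big_cons -IH -RintegralD; last 3 first.
- exact: std_simplex_measurable.
- exact: facet_integrable.
- apply: (@facet_integrable (fun x => \sum_(j <- r) g j x)).
  by apply: (continuous_sumr (V := R^o)) => j _; exact: cg.
by congr Rintegral; apply/funext => t; rewrite big_cons.
Qed.

End facet.

End mesh_functions.

(** * The norms of the statement as quadratic forms of the scheme *)

Section scheme_norms.
Context (R : realType) (d : nat) (M : mesh R d) (fd : facet_data M).

Lemma diam_ge0 (X : set 'rV[R]_d) : 0 <= diam X.
Proof.
rewrite /diam; set S := [set r | _].
(* Without a supremum, [sup] takes the default value 0. *)
have [hS|hS] := pselect (has_sup S); last by rewrite sup_out.
have [r Sr] := hS.1.
apply: (@le_trans _ _ r); last by apply: (sup_upper_bound hS).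
by have [x [y [_ _ ->]]] := Sr; rewrite sqrtr_ge0.
Qed.

Lemma Linfty_norm_ge0 n a b (X : set 'rV[R]_n) (g : 'rV[R]_n -> 'M[R]_(a, b)) :
  0 <= Linfty_norm X g.
Proof. by rewrite fine_ge0// Lnorm_ge0. Qed.

Lemma penalty_ge0 (eta normA : R) F : 0 < eta -> 0 <= normA ->
  0 <= penalty fd eta normA F.
Proof.
move=> eta0 A0; rewrite mulr_ge0// invr_ge0 mulr_ge0 ?invr_ge0 ?(ltW eta0)//.
by rewrite le_min !diam_ge0.
Qed.

Lemma Spmx_component N p (w : broken M 'rV[R]_N) i :
  Spmx p w -> Sp p (component w i).
Proof. by move=> Sw k; exact: (Sw 0 i k). Qed.

(** The stabilization term tested with [w] itself. Exchanging the sum over components with the facet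
    integral requires integrable traces, provided by the continuity of polynomials. *)
Lemma L2norm_facets_jump N p (eta normA : R) (w : broken M 'rV[R]_N) :
  0 < eta -> 0 <= normA -> Spmx p w ->
  L2norm_facets (fun F x =>
    Num.sqrt (penalty fd eta normA F) *: jump_vec fd w F x) ^+ 2 =
  \sum_i sh fd eta normA (component w i) (component w i).
Proof.
move=> eta0 A0 Sw; rewrite /L2norm_facets sqr_sqrtr; last first.
  by apply: sumr_ge0 => F _; apply: facet_int_ge0 => x; rewrite exprn_ge0// sqrtr_ge0.
rewrite exchange_big; apply: eq_bigr => F _ /=.
rewrite -facet_int_sum.
  congr facet_int; apply/funext => x; rewrite enorm_sqr innerZl innerZr mulrA.
  rewrite -expr2 sqr_sqrtr ?penalty_ge0// -mulr_sumr inner_rows; congr (_ * _).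
  by apply: eq_bigr => i _; rewrite rowK.
move=> i; have cw k : continuous (component w i k).
  exact: (is_poly_continuous (Spmx_component i Sw k)).
rewrite (_ : (fun x => _) = fun x => (penalty fd eta normA F *
    inner (normal fd F) (normal fd F)) *
  ((component w i (side1 fd F) x - component w i (side2 fd F) x) *
   (component w i (side1 fd F) x - component w i (side2 fd F) x))); last first.
  by apply/funext => x; rewrite /jump innerZl innerZr; ring.
have cB : continuous (fun x => component w i (side1 fd F) x - component w i (side2 fd F) x).
  by move=> x; apply: continuousB; exact: cw.
by move=> x; exact: (cvgM (cvg_cst _) (cvgM (cB x) (cB x))).
Qed.

Lemma spd_form_ge0 p (c : broken M R -> broken M R -> R) v :
  spd_form p c -> Sp p v -> 0 <= c v v.
Proof.
move=> [_ clin cpos] Sv.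
have [nz|z] := pselect (exists k x, v k x != 0); first by rewrite ltW// cpos.
(* Here [v] vanishes identically, so linearity applied to this identity gives [c v v = 2 c v v]. *)
have v0 : v = (fun k x => 1 * v k x + v k x).
  apply/funext => k; apply/funext => x.
  suff -> : v k x = 0 by rewrite mulr0 addr0.
  by apply: contra_notP z => /eqP nz; exists k, x.
by have := clin 1 v v v Sv Sv Sv; rewrite -v0; lra.
Qed.

Lemma cnorm_sqr N p (c : broken M R -> broken M R -> R) (w : broken M 'rV[R]_N) :
  spd_form p c -> Spmx p w -> cnorm c w ^+ 2 = cform c w w.
Proof.
move=> hc Sw; rewrite sqr_sqrtr//; apply: sumr_ge0 => i _.
exact: (spd_form_ge0 hc (Spmx_component i Sw)).
Qed.

End scheme_norms.

Lemma continuous_within_closure (T U : topologicalType) (D : set T) (g : T -> U) :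
  open D -> {within closure D, continuous g} ->
  forall y, D y -> {for y, continuous g}.
Proof.
move=> oD cg y Dy.
have : {within D, continuous g}.
  exact: continuous_subspaceW (@subset_closure _ D) cg.
by rewrite continuous_open_subspace//; apply; rewrite inE.
Qed.

Lemma bounded_closure_compact (R : realType) n (D : set 'rV[R]_n) :
  bounded_set D -> compact (closure D).
Proof.
move=> /bounded_set_box[C DC].
pose K := [set z : 'rV[R]_n | forall i, `[- C, C]%classic (z 0 i)].
have cK : compact K.
  by apply: (@rV_compact R n (fun=> `[- C, C]%classic)) => i; exact: segment_compact.
apply: (subclosed_compact _ cK); first exact: closed_closure.
rewrite [X in _ `<=` X](closure_id K).1; last first.
  by apply: compact_closed cK; exact: norm_hausdorff.
by apply: closure_subset => x Dx i; rewrite /= in_itv/= -ler_norml; exact: DC.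
Qed.

(** * The entropy estimate for a single time step *)

Section one_step.
Context (R : realType) (d N : nat).
Context (Om : set 'rV[R]_d) (D : set 'rV[R]_N).
Context (A : 'rV[R]_N -> 'M[R]_N) (f : 'rV[R]_N -> 'rV[R]_N).
Context (s : 'rV[R]_N -> R) (u : 'rV[R]_N -> 'rV[R]_N) (gamma Cf : R).
Hypotheses (oOm : open Om) (bOm : bounded_set Om) (oD : open D) (bD : bounded_set D).
Hypotheses (hA : {within closure D, continuous A})
  (hf : {within closure D, continuous f})
  (hsC2 : C2_on D s) (hsC0 : {within closure D, continuous s})
  (hsconv : convex_fun_on D s)
  (huD : forall w, D (u w)) (hsu : forall w, grad s (u w) = w)
  (hus : forall rho, D rho -> u (grad s rho) = rho)
  (huC1 : C1_on setT u)
  (hcoer : forall (z : 'cV[R]_N) rho, D rho ->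
     gamma * enorm z ^+ 2 <= inner z (hess s rho *m A rho *m z))
  (hreact : forall rho, D rho -> inner (f rho) (grad s rho) <= Cf).

Let bm := @bounded_measurable _ 'rV[R]_d R Om.

Let mOm : measurable Om.
Proof. exact: open_measurable_rV. Qed.

Let Omoo : (lebesgue_rV R d Om < +oo)%E.
Proof. exact: lebesgue_rV_bounded. Qed.

Let int_bm h : bm h -> (lebesgue_rV R d).-integrable Om (EFin \o h).
Proof. exact: bounded_measurable_integrable. Qed.

Let cu : continuous u.
Proof. by move=> w; apply: differentiable_continuous; exact: (huC1 _).1. Qed.

(** By symmetry of the Hessian, [A^T s''] is the transpose of [s'' A] and has the same quadratic
    form; the coercivity hypothesis then applies to each column of [S]. *)
Lemma coercive_mx n (S : 'M[R]_(N, n)) rho : D rho ->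
  gamma * enorm S ^+ 2 <= inner ((A rho)^T *m hess s rho *m S) S.
Proof.
move=> Drho; rewrite -mulmxA inner_trmxl -{1}(hess_sym oD hsC2 Drho) inner_trmxl.
rewrite enorm_sqr !inner_col mulr_sumr; apply: ler_sum => j _.
have := hcoer (col j S) Drho; rewrite enorm_sqr => /le_trans; apply.
by rewrite !colE !mulmxA.
Qed.

(** The values of [rho] may accumulate at the boundary of [D], so boundedness comes from the
    continuity of [s] on the compact closure. *)
Lemma bounded_measurable_entropy (rho : 'rV[R]_d -> 'rV[R]_N) :
  (forall x, Om x -> D (rho x)) -> (forall i, bm (fun x => rho x 0 i)) ->
  bm (s \o rho).
Proof.
move=> rhoD brho; split.
  apply: (measurable_continuous_comp mOm _ oD rhoD); first by move=> i; have [] := brho i.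
  exact: continuous_within_closure.
have /compact_bounded/pinfty_ex_gt0[B _ sB] : compact (s @` closure D).
  by apply: continuous_compact => //; exact: bounded_closure_compact.
exists B => x Omx; have : (s @` closure D) (s (rho x)); last exact: sB.
by exists (rho x) => //; apply: subset_closure; exact: rhoD.
Qed.

(** Continuity of [G] inside [D] is enough, even if [G] blows up at the boundary as [s''] may: since
    [w] is bounded, [G] is composed with [u] first and [G o u] is continuous on the whole space. *)
Lemma bounded_measurable_entries (w : 'rV[R]_d -> 'rV[R]_N) a b
    (G : 'rV[R]_N -> 'M[R]_(a, b)) :
  (forall i, bm (fun x => w x 0 i)) ->
  (forall y, D y -> {for y, continuous G}) ->
  forall i j, bm (fun x => G (u (w x)) i j).
Proof.
move=> bw cG i j.
apply: (bounded_measurable_comp mOm (g := fun y => G (u y) i j)) => // y.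
apply: (continuous_comp (f := fun y => G (u y)) (g := fun P : 'M[R]_(a, b) => P i j)).
  by apply: continuous_comp; [exact: cu|exact: cG].
exact: coord_continuous.
Qed.

Context (M : mesh R d) (fd : facet_data M) (p : nat) (eta : R)
  (c : broken M R -> broken M R -> R)
  (zeta : broken M 'rV[R]_N -> broken M 'M[R]_(N, d)).
Hypotheses (heta : 0 < eta) (hc : spd_form p c).

(** The entropy is compared at [rho], valued in [D], whereas the scheme contains [rho_old], which in
    the first step is a projection that may leave [D]. The only link asked for is that both give the
    same pairing with [w]; later steps take [rho] equal to [rho_old]. *)
Lemma LDG_step_entropy (eps tau : R) (rho_old rho : 'rV[R]_d -> 'rV[R]_N)
    (w : broken M 'rV[R]_N) (sigma : broken M 'M[R]_(N, d)) :
  0 < tau ->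
  LDG_step Om fd D A f s u p eta c zeta eps tau rho_old w sigma ->
  (forall x, Om x -> D (rho x)) -> (forall i, bm (fun x => rho x 0 i)) ->
  intOm Om (fun x => inner (u (assemble w x) - rho_old x) (assemble w x)) =
  intOm Om (fun x => inner (u (assemble w x) - rho x) (assemble w x)) ->
  eps * tau * cnorm c w ^+ 2 + intOm Om (fun x => s (u (assemble w x)))
    + gamma * tau * L2norm Om (assemble sigma) ^+ 2
    + tau * L2norm_facets (fun F x =>
        Num.sqrt (penalty fd eta (Linfty_norm D A) F) *: jump_vec fd w F x) ^+ 2
  <= intOm Om (fun x => s (rho x)) + Cf * tau * volume Om.
Proof.
move=> tau0 [Sw Ssig E1 E2] rhoD brho rho_eq.
have bw i : bm (fun x => assemble w x 0 i).
  exact: bounded_measurable_assemble Sw 0 i.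
have bsig := bounded_measurable_assemble mOm bOm Ssig.
have bu i : bm (fun x => u (assemble w x) 0 i).
  by apply: (@bounded_measurable_entries _ 1 N id bw _ 0 i) => y _; exact: cvg_id.
have bA := bounded_measurable_entries bw (continuous_within_closure oD hA).
have bf := bounded_measurable_entries bw (continuous_within_closure oD hf).
have bH : forall i j, bm (fun x => hess s (u (assemble w x)) i j).
  by apply: bounded_measurable_entries => // y Dy; exact: (hsC2.2 y Dy).2.
have row_bm (v : 'rV[R]_d -> 'rV[R]_N) : (forall i, bm (fun x => v x 0 i)) ->
    forall i j, bm (fun x => v x i j).
  by move=> bv i j; rewrite ord1.
have := E2 w Sw; rewrite -(cnorm_sqr hc Sw) rho_eq.
rewrite -(L2norm_facets_jump fd heta (Linfty_norm_ge0 D A) Sw).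
(* Once [A] is transposed onto [zeta w], the flux term is the right-hand side of the first equation
   at [phi = sigma]. *)
have -> : intOm Om (fun x => inner (A (u (assemble w x)) *m assemble sigma x)
    (assemble (zeta w) x)) = intOm Om (fun x => inner
      ((A (u (assemble w x)))^T *m hess s (u (assemble w x)) *m assemble sigma x)
      (assemble sigma x)).
  rewrite (E1 _ Ssig); congr intOm; apply/funext => x.
  by rewrite inner_trmxl innerC.
set I1 := intOm Om (fun x => inner (_ - _) _).
set I2 := intOm Om (fun x => inner (_ *m _) _).
set I3 := intOm Om (fun x => inner (f _) _).
have K1 : gamma * L2norm Om (assemble sigma) ^+ 2 <= I2.
  rewrite sqr_sqrtr; last by apply: Rintegral_ge0 => x _; rewrite exprn_ge0// sqrtr_ge0.
  have bS : bm (fun x => enorm (assemble sigma x) ^+ 2).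
    rewrite (funext (fun x => enorm_sqr (assemble sigma x))).
    exact: bounded_measurable_inner.
  rewrite -RintegralZl//; last exact: int_bm.
  apply: le_Rintegral => //.
  - by apply: int_bm; apply: bounded_measurableM => //; exact: bounded_measurable_cst.
  - apply: int_bm; apply: bounded_measurable_inner => //.
    apply: bounded_measurable_mulmx => //; apply: bounded_measurable_mulmx => //.
    move=> i j; rewrite (_ : (fun x => _) = fun x => A (u (assemble w x)) j i).
      exact: bA.
    by apply/funext => x; rewrite mxE.
  - by move=> x _; exact: coercive_mx.
have K2 : I3 <= Cf * volume Om.
  rewrite /volume -Rintegral_cst//; apply: le_Rintegral => //.
  - by apply: int_bm; apply: bounded_measurable_inner => //; exact: row_bm.
  - by apply: int_bm; exact: bounded_measurable_cst.
  (* Writing [w] as the gradient of [s] at [u(w)] brings the source term into the form bounded by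
     [Cf]. *)
  - by move=> x _; rewrite -[X in inner _ X]hsu; exact: hreact.
have K3 : intOm Om (fun x => s (u (assemble w x))) - intOm Om (fun x => s (rho x))
    <= I1.
  have bsu : bm (fun x => s (u (assemble w x))).
    by apply: (@bounded_measurable_entropy (fun x => u (assemble w x))).
  have bsr : bm (fun x => s (rho x)) by exact: bounded_measurable_entropy.
  rewrite -RintegralB//; [|exact: int_bm|exact: int_bm].
  apply: le_Rintegral => //.
  - by apply: int_bm; exact: bounded_measurableB.
  - apply: int_bm; apply: bounded_measurable_inner; last exact: row_bm.
    apply: row_bm => i.
    rewrite (_ : (fun x => _) = fun x => u (assemble w x) 0 i - rho x 0 i).
      exact: (bounded_measurableB (bu i) (brho i)).
    by apply/funext => x; rewrite !mxE.
  - move=> x Omx.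
    (* The base point is the gradient of [s] at [rho x], which [u] maps back to [rho x]. *)
    have := @entropy_tangent R N D s u oD hsC2.1 hsconv (fun v => (@huC1 v Logic.I).1)
      huD hsu (grad s (rho x)) (assemble w x).
    rewrite hus; last exact: rhoD.
    rewrite !innerBr innerBl ![inner (assemble w x) _]innerC; lra.
move: K1 K2 => /(ler_wpM2l (ltW tau0)) K1 /(ler_wpM2l (ltW tau0)) K2.
lra.
Qed.

End one_step.

(** * The initial datum and the summation over time steps *)

Theorem theorem3p1 (R : realType) (d N : nat) (T : R)
  (Om : set 'rV[R]_d) (D : set 'rV[R]_N)
  (A : 'rV[R]_N -> 'M[R]_N) (f : 'rV[R]_N -> 'rV[R]_N)
  (s : 'rV[R]_N -> R) (u : 'rV[R]_N -> 'rV[R]_N) (gamma Cf : R)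
  (rho0 : 'rV[R]_d -> 'rV[R]_N)
  (hd : (1 <= d <= 3)%N) (hT : 0 < T)
  (hOm : bounded_domain Om) (hOmpoly : polytopic Om)
  (hOmlip : lipschitz_boundary Om)
  (hD : bounded_domain D) (hDpos : forall rho, D rho -> forall i, 0 < rho 0 i)
  (hA : {within closure D, continuous A})
  (hf : {within closure D, continuous f})
  (hsC2 : C2_on D s) (hsC0 : {within closure D, continuous s})
  (hspos : forall rho, closure D rho -> 0 < s rho)
  (hsconv : convex_fun_on D s)
  (huD : forall w, D (u w)) (hsu : forall w, grad s (u w) = w)
  (hus : forall rho, D rho -> u (grad s rho) = rho)
  (huC1 : C1_on setT u)
  (hgamma : 0 < gamma) (hCf : 0 <= Cf)
  (hcoer : forall (z : 'cV[R]_N) rho, D rho ->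
     gamma * enorm z ^+ 2 <= inner z (hess s rho *m A rho *m z))
  (hreact : forall rho, D rho -> inner (f rho) (grad s rho) <= Cf)
  (hrho0 : in_Linfty Om rho0)
  (hrho0D : {ae lebesgue_rV R d, forall x, Om x -> D (rho0 x)})
  (M : mesh R d) (fd : facet_data M) (Ups : R) (p : nat) (eta : R)
  (c : broken M R -> broken M R -> R)
  (zeta : broken M 'rV[R]_N -> broken M 'M[R]_(N, d))
  (hM : conforming_mesh Om M) (hfd : valid_facet_data fd)
  (hUps : 0 < Ups) (hMreg : (2 <= d)%N -> shape_regular M Ups)
  (heta : 0 < eta) (hc : spd_form p c)
  (hzeta : is_LDG_gradient Om fd p zeta)
  (eps : R) (heps : 0 < eps)
  (Nt : nat) (t : nat -> R) (ht0 : t 0%N = 0) (htT : t Nt = T)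
  (ht : forall n, (n < Nt)%N -> t n < t n.+1)
  (rho0h : broken M 'rV[R]_N) (w : nat -> broken M 'rV[R]_N)
  (sigma : nat -> broken M 'M[R]_(N, d))
  (hrho0h : is_L2_projection Om p rho0 rho0h)
  (hstep : forall n, (n < Nt)%N ->
     LDG_step Om fd D A f s u p eta c zeta eps (t n.+1 - t n)
       (if n is 0 then assemble rho0h else fun x => u (assemble (w n) x))
       (w n.+1) (sigma n.+1)) :
  let tau n := t n - t n.-1 in
  let entropy n := intOm Om (fun x => s (u (assemble (w n) x))) in
  let jumps n := L2norm_facets (fun F x =>
    Num.sqrt (penalty fd eta (Linfty_norm D A) F) *: jump_vec fd (w n) F x) in
  let sigma_norm n := L2norm Om (assemble (sigma n)) in
  [/\ eps * tau 1%N * cnorm c (w 1%N) ^+ 2 + entropy 1%N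
        + gamma * tau 1%N * sigma_norm 1%N ^+ 2 + tau 1%N * jumps 1%N ^+ 2
      <= intOm Om (fun x => s (rho0 x)) + Cf * tau 1%N * volume Om,
      forall n, (0 < n < Nt)%N ->
        eps * tau n.+1 * cnorm c (w n.+1) ^+ 2 + entropy n.+1
          + gamma * tau n.+1 * sigma_norm n.+1 ^+ 2
          + tau n.+1 * jumps n.+1 ^+ 2
        <= entropy n + Cf * tau n.+1 * volume Om &
      eps * (\sum_(n < Nt) tau n.+1 * cnorm c (w n.+1) ^+ 2) + entropy Nt
        + gamma * (\sum_(n < Nt) tau n.+1 * sigma_norm n.+1 ^+ 2)
        + \sum_(n < Nt) tau n.+1 * jumps n.+1 ^+ 2
      <= intOm Om (fun x => s (rho0 x)) + Cf * T * volume Om].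
Proof.
move=> tau entropy jumps sigma_norm.
have [_ oOm _ bOm] := hOm; have [_ oD _ bD] := hD.
have mOm : measurable Om by exact: open_measurable_rV.
have Omoo : (lebesgue_rV R d Om < +oo)%E by exact: lebesgue_rV_bounded.
have cu : continuous u.
  by move=> v; apply: differentiable_continuous; exact: (@huC1 v Logic.I).1.
have step n rho_old rho := @LDG_step_entropy R d N Om D A f s u gamma Cf oOm bOm oD
  bD hA hf hsC2 hsC0 hsconv huD hsu hus huC1 hcoer hreact M fd p eta c zeta
  heta hc eps (tau n.+1) rho_old rho (w n.+1) (sigma n.+1).
have tau0 n : (n < Nt)%N -> 0 < tau n.+1 by move=> nN; rewrite subr_gt0 ht.
have Nt0 : (0 < Nt)%N.
  by rewrite lt0n; apply/eqP => N0; move: hT; rewrite -htT N0 ht0 ltxx.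
have Sw n : (n < Nt)%N -> Spmx p (w n.+1) by move=> /hstep[].
have bw n (nN : (n < Nt)%N) i := bounded_measurable_assemble mOm bOm (Sw n nN) 0 i.
have bu n (nN : (n < Nt)%N) i :
    bounded_measurable Om (fun x => u (assemble (w n.+1) x) 0 i).
  apply: (bounded_measurable_comp mOm (g := fun y => u y 0 i)) => [y|]; last exact: bw.
  apply: (continuous_comp (f := u) (g := fun P : 'rV[R]_N => P 0 i)); first exact: cu.
  exact: coord_continuous.
have row_bm (v : 'rV[R]_d -> 'rV[R]_N) :
    (forall i, bounded_measurable Om (fun x => v x 0 i)) ->
    forall i j, bounded_measurable Om (fun x => v x i j).
  by move=> bv i j; rewrite ord1.
have [B [mB B0 rhoB]] := hrho0D.
(* On the measurable null set [B] containing the points of [Om] where [rho0] leaves [D], the datum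
   is replaced by [u 0], a point of [D]; boundedness of the result then follows from that of [D]. *)
pose rho x := if x \in B then u 0 else rho0 x.
have rhoD x : Om x -> D (rho x).
  move=> Omx; rewrite /rho; case: ifPn => [//|]; rewrite notin_setE => nBx.
  by apply: contra_notP nBx => nD; apply: rhoB => /= /(_ Omx).
have brho i : bounded_measurable Om (fun x => rho x 0 i).
  split; last first.
    by have [C DC] := bounded_set_box bD; exists C => x /rhoD /DC.
  rewrite (_ : (fun x => _) = fun x => \1_B x * u 0 0 i + \1_(~` B) x * rho0 x 0 i).
    apply: measurable_funD; apply: measurable_funM; first exact: measurable_indic.
    - exact: measurable_cst.
    - by apply: measurable_indic; exact: measurableC.
    - exact: hrho0.1.
  apply/funext => x; rewrite /rho !indicE in_setC.
  by case: (x \in B); rewrite /= ?mul1r ?mul0r ?addr0 ?add0r.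
(* The dependence of [h] on [x] serves the pairing of [rho0] with [w]; the entropy integral takes
   [h] constant in [x]. *)
have intOm_rho (h : 'rV[R]_d -> 'rV[R]_N -> R) :
    intOm Om (fun x => h x (rho0 x)) = intOm Om (fun x => h x (rho x)).
  congr fine; apply: (integral_eq_off_negligible mB B0) => x _ nBx.
  by rewrite /rho memNset.
have int_bm h : bounded_measurable Om h ->
    (lebesgue_rV R d).-integrable Om (EFin \o h).
  exact: bounded_measurable_integrable.
have first_step : eps * tau 1%N * cnorm c (w 1%N) ^+ 2 + entropy 1%N
    + gamma * tau 1%N * sigma_norm 1%N ^+ 2 + tau 1%N * jumps 1%N ^+ 2
    <= intOm Om (fun x => s (rho0 x)) + Cf * tau 1%N * volume Om.
  rewrite (intOm_rho (fun _ => s)).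
  apply: (step 0%N (assemble rho0h) rho (tau0 _ Nt0) (hstep _ Nt0) rhoD brho).
  have brho0h := bounded_measurable_assemble mOm bOm hrho0h.1.
  (* The projection identity concerns the pairing of the datum with [w] alone, so the difference is
     split first. *)
  have split_int (v : 'rV[R]_d -> 'rV[R]_N) : (forall i, bounded_measurable Om (fun x => v x 0 i)) ->
      intOm Om (fun x => inner (u (assemble (w 1%N) x) - v x) (assemble (w 1%N) x)) =
      intOm Om (fun x => inner (u (assemble (w 1%N) x)) (assemble (w 1%N) x)) -
      intOm Om (fun x => inner (v x) (assemble (w 1%N) x)).
    move=> bv; rewrite /intOm -RintegralB//.
    - by congr Rintegral; apply/funext => x; rewrite innerBl.
    - apply: int_bm; apply: bounded_measurable_inner; apply: row_bm => i.
        exact: bu.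
      exact: bw.
    - apply: int_bm; apply: bounded_measurable_inner; apply: row_bm => i.
        exact: bv.
      exact: bw.
  rewrite (split_int rho)// split_int; last by move=> i; exact: brho0h.
  by rewrite hrho0h.2; [rewrite (intOm_rho (fun x y => inner y _))|exact: Sw].
have next_step n : (0 < n < Nt)%N ->
    eps * tau n.+1 * cnorm c (w n.+1) ^+ 2 + entropy n.+1
      + gamma * tau n.+1 * sigma_norm n.+1 ^+ 2 + tau n.+1 * jumps n.+1 ^+ 2
    <= entropy n + Cf * tau n.+1 * volume Om.
  case: n => // n nN; have nN' := ltnW nN.
  apply: (step n.+1 _ (fun x => u (assemble (w n.+1) x)) (tau0 _ nN) (hstep _ nN)) => //.
  by move=> i; exact: bu.
split => //.
(* The steps telescope: as [t 0 = 0], those up to index [m.+1] add up to [t m.+1], which stands for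
   [T] in the induction, while the intermediate entropies cancel. *)
suff total m : (m < Nt)%N ->
    eps * (\sum_(n < m.+1) tau n.+1 * cnorm c (w n.+1) ^+ 2) + entropy m.+1
      + gamma * (\sum_(n < m.+1) tau n.+1 * sigma_norm n.+1 ^+ 2)
      + \sum_(n < m.+1) tau n.+1 * jumps n.+1 ^+ 2
    <= intOm Om (fun x => s (rho0 x)) + Cf * t m.+1 * volume Om.
  by have := total Nt.-1; rewrite prednK// htT; apply.
elim: m => [_|m IH mN].
  by rewrite !big_ord1; move: first_step; rewrite /tau /= ht0 subr0; lra.
have := IH (ltnW mN); have := next_step m.+1 mN => step_m IHm.
rewrite 3![\sum_(n < m.+2) _]big_ord_recr /=.
have tauE : tau m.+2 = t m.+2 - t m.+1 by [].
move: step_m IHm; rewrite tauE.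
move: (\sum_(n < _) _) (\sum_(n < _) _) (\sum_(n < _) _) => S1 S2 S3.
move: (entropy _) (entropy _) (cnorm _ _) (jumps _) (sigma_norm _) => e1 e2 k1 k2 k3.
by move: (intOm _ _) (volume _) (t _) (t _) => I0 V t1 t2; lra.
Qed.
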